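(* Let $\kappa\in\mathbb{C}$ be arbitrary. Let $\bm{\lambda}=(\lambda_n)_{n\ge0}$, $\bm{\mu}=(\mu_n)_{n\ge1}$ be sequences of complex numbers and $\bm{\eta}$ a linear functional on $\mathrm{span}\{b(n)\mid n\ge0\}$ with $\eta_n=\bm{\eta}(b(n))$. Assume that there are integers $N\ge0$, $M\ge1$, $P\ge0$ such that $\lambda_N\neq0$, $\mu_M\neq0$, $\eta_P\neq0$ and $\lambda_{N+i}=\mu_{M+i}=\eta_{P+i}=0$ for all $i>0$. Put $$q=\max\{M,N+1\},\qquad r=\max\{M+N+1,\,2M,\,P+1\}.$$ Regard $M_1(\bm{\lambda},\bm{\mu})\otimes N_1(\bm{\eta})$ as a $V^\kappa(\mathfrak{sl}_2)$-module via the Wakimoto realization and let $w=v_{\bm{\lambda},\bm{\mu}}\otimes v_{\bm{\eta}}$ be the tensor product of the Whittaker vectors. Then the submodule $U(\widehat{\mathfrak{sl}}_2)w$ is a generalized Whittaker module (for $\mathcal{P}_{q,r}$) with generating $\psi$-Whittaker vector $w$, where the Whittaker function $\psi:\mathcal{P}_{q,r}\to\mathbb{C}$ is the Lie algebra homomorphism with $\psi(K)=\kappa$ and, for all $i\ge0$, $\psi(e(i))=A_i$, $\psi(h(q+i))=B_i$, $\psi(f(r+i))=C_i$, with $$A_i=\lambda_i,\qquad B_i=-2\sum_{l=1}^{M}\mu_l\lambda_{q+i-l}+\eta_{q+i},$$ $$C_i=-\sum_{\substack{k_1,k_2\ge1,\ k_3\ge0 \\ k_1+k_2+k_3=r+i}}\mu_{k_1}\mu_{k_2}\lambda_{k_3}+\sum_{\substack{j_1\ge1,\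 j_2\ge0 \\ j_1+j_2=r+i}}\mu_{j_1}\eta_{j_2}-\kappa(r+i)\mu_{r+i}.$$
   Context: **Affine algebra.** $\mathfrak{sl}_2$ has standard basis $e,f,h$ with $[e,f]=h$, $[h,e]=2e$, $[h,f]=-2f$ and invariant form $(e,f)=1$, $(h,h)=2$. $\widehat{\mathfrak{sl}}_2=\mathfrak{sl}_2\otimes\mathbb{C}[t,t^{-1}]\oplus\mathbb{C}K$ with $K$ central, $x(n)=x\otimes t^n$, and $[x(n),y(m)]=[x,y](n+m)+n(x,y)\delta_{n+m,0}K$. $V^\kappa(\mathfrak{sl}_2)$ is the universal affine vertex algebra of level $\kappa$; its (weak) modules are the same as smooth $\widehat{\mathfrak{sl}}_2$-modules of level $\kappa$ (smooth: for each vector $w$ and each $x\in\mathfrak{sl}_2$, $x(n)w=0$ for $n\gg0$). **Generalized Whittaker modules.** For integers $0<q<r$, $\mathcal{P}_{q,r}\subset\widehat{\mathfrak{sl}}_2$ is the Lie subalgebra generated by $K$ and $\{e(n),\,h(m),\,f(p)\mid n\ge0,\ m\ge q,\ p\ge r\}$. For a Lie algebra homomorphism $\psi:\mathcal{P}_{q,r}\to\mathbb{C}$ with $\psi(K)=\kappa$, a vector $v$ in a $V^\kappa(\mathfrak{sl}_2)$-module is a $\psi$-Whittaker vector if $x\cdot v=\psi(x)v$ for all $x\in\mathcal{P}_{q,r}$. A generalized Whittaker module with Whittaker function $\psi$ is a module generated by a nonzero $\psi$-Whittaker vector; equivalently, a nonzero quotient of the universal one $\widehat{R}(\psi)=U(\widehat{\mathfrak{sl}}_2)\otimes_{U(\mathcal{P}_{q,r})}\mathbb{C}v$,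 where $x\cdot v=\psi(x)v$ for $x\in\mathcal{P}_{q,r}$. **Weyl algebra and its Whittaker modules.** $\widehat{\mathcal{A}}$ is the associative algebra generated by $a(n),a^*(n)$, $n\in\mathbb{Z}$, with only nontrivial commutators $[a(n),a^*(m)]=\delta_{n+m,0}$. For sequences $\bm{\lambda}=(\lambda_n)_{n\ge0}$, $\bm{\mu}=(\mu_n)_{n\ge1}$ that vanish for $n\gg0$, $M_1(\bm{\lambda},\bm{\mu})=\widehat{\mathcal{A}}/I$, where $I$ is the left ideal generated by $a(i)-\lambda_i$ $(i\ge0)$ and $a^*(j)-\mu_j$ $(j\ge1)$; its Whittaker vector $v_{\bm{\lambda},\bm{\mu}}$ is the image of $1$. The fields are $a(z)=\sum_na(n)z^{-n-1}$, $a^*(z)=\sum_na^*(n)z^{-n}$. **Heisenberg algebra.** It has generators $b(n)$, $n\in\mathbb{Z}$, with $[b(n),b(m)]=2(\kappa+2)n\delta_{n+m,0}$, and field $b(z)=\sum_nb(n)z^{-n-1}$. For $\bm{\eta}$ as in the claim, $N_1(\bm{\eta})$ is the module induced from the one-dimensional module $\mathbb{C}v_{\bm{\eta}}$ of $\mathrm{span}\{b(n)\mid n\ge0\}$ with $b(n)v_{\bm{\eta}}=\eta_nv_{\bm{\eta}}$ for $n\ge0$. **Wakimoto realization.** With $x(z)=\sum_nx(n)z^{-n-1}$, the formulas $$e(z)=a(z),\quad h(z)=-2{:}a^*(z)a(z){:}+b(z),\quad f(z)=-{:}a^*(z)^2a(z){:}+\kappa\,\partial_za^*(z)+a^*(z)b(z)$$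 make $M_1(\bm{\lambda},\bm{\mu})\otimes N_1(\bm{\eta})$ a $V^\kappa(\mathfrak{sl}_2)$-module. Normal ordering is with respect to the vacuum annihilators $a(n)$ $(n\ge0)$ and $a^*(n)$ $(n\ge1)$, which are placed on the right. *)

(* Defs.v *)
From HB Require Import structures.
From mathcomp Require Import all_boot all_order all_algebra finmap.
From mathcomp Require Import boolp classical_sets fsbigop reals.
From mathcomp Require Import complex.
From mathcomp.multinomials Require Import monalg.

Set Implicit Arguments.
Unset Strict Implicit.
Unset Printing Implicit Defensive.

Import GRing.Theory.

Local Open Scope classical_set_scope.
Local Open Scope quotient_scope.
Local Open Scope ring_scope.

Section Submodules.
Variables (F : pzRingType) (V : lmodType F).

Definition subspace (S : set V) : Prop :=
  S 0 /\ forall (a : F) u v, S u -> S v -> S (a *: u + v).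

Definition spanp (G : set V) : {pred V} :=
  fun x => `[< forall S : set V, subspace S -> G `<=` S -> S x >].

Lemma spanp_sub (G : set V) x : G x -> x \in spanp G.
Proof. by move=> Gx; apply/asboolP => S _; apply. Qed.

Lemma spanp_min (G S : set V) : subspace S -> G `<=` S ->
  forall x, x \in spanp G -> S x.
Proof. by move=> mS GS x /asboolP; apply. Qed.

Lemma spanp_submod (G : set V) : submod_closed (spanp G).
Proof.
split=> [|a u v /asboolP Gu /asboolP Gv]; apply/asboolP => S mS GS.
  by case: mS.
by apply: mS.2; [apply: Gu | apply: Gv].
Qed.

HB.instance Definition _ (G : set V) :=
  GRing.isSubmodClosed.Build F V (spanp G) (spanp_submod G).
HB.instance Definition _ (G : set V) :=
  GRing.isZmodClosed.Build V (spanp G)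
    (GRing.submod_closedB (spanp_submod G)).

Lemma spanp0 (G : set V) : 0 \in spanp G.
Proof. exact: (spanp_submod G).1. Qed.

Lemma spanp_lin (G : set V) a x y :
  x \in spanp G -> y \in spanp G -> a *: x + y \in spanp G.
Proof. exact: (spanp_submod G).2. Qed.

Lemma spanpD (G : set V) x y :
  x \in spanp G -> y \in spanp G -> x + y \in spanp G.
Proof. by move=> Gx Gy; rewrite -[x]scale1r spanp_lin. Qed.

End Submodules.

Section QuotientModule.
Variables (F : pzRingType) (V : lmodType F) (G : set V).

Definition quotmod : Type := Quotient.quot (spanp G).

HB.instance Definition _ := GRing.Zmodule.on quotmod.

Definition qproj (v : V) : quotmod := \pi_(Quotient.quot (spanp G)) v.
Definition qrepr (x : quotmod) : V := repr (x : Quotient.quot (spanp G)).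

Lemma qreprK : cancel qrepr qproj.
Proof. exact: reprK. Qed.

Lemma qproj_eq u v : (qproj u == qproj v) = (u - v \in spanp G).
Proof. by rewrite Quotient.idealrBE. Qed.

Lemma qreprP v : qrepr (qproj v) - v \in spanp G.
Proof. by rewrite -qproj_eq qreprK. Qed.

Lemma qprojD u v : qproj (u + v) = qproj u + qproj v.
Proof. exact: raddfD. Qed.

Definition qscale (a : F) (x : quotmod) : quotmod := qproj (a *: qrepr x).

Lemma qscaleE a v : qscale a (qproj v) = qproj (a *: v).
Proof. by apply/eqP; rewrite qproj_eq -scalerBr rpredZ ?qreprP. Qed.

Lemma qscaleA a b x : qscale a (qscale b x) = qscale (a * b) x.
Proof. by rewrite -[x]qreprK !qscaleE scalerA. Qed.
Lemma qscale1 : left_id 1 qscale.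
Proof. by move=> x; rewrite -[x]qreprK qscaleE scale1r. Qed.
Lemma qscaleDr : right_distributive qscale +%R.
Proof.
by move=> a x y; rewrite -[x]qreprK -[y]qreprK -qprojD !qscaleE -qprojD scalerDr.
Qed.
Lemma qscaleDl x : {morph qscale^~ x : a b / a + b}.
Proof. by move=> a b; rewrite -[x]qreprK !qscaleE -qprojD scalerDl. Qed.

HB.instance Definition _ := GRing.Zmodule_isLmodule.Build F quotmod
  qscaleA qscale1 qscaleDr qscaleDl.

Lemma qproj_linear : linear qproj.
Proof. by move=> a u v; rewrite qprojD -qscaleE. Qed.

HB.instance Definition _ := GRing.isLinear.Build F V quotmod *:%R qproj
  qproj_linear.

End QuotientModule.

Arguments qproj {F V} G v.
Arguments qrepr {F V} G x.

Section TensorProduct.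
Variables (F : comNzRingType) (M N : lmodType F).

Local Notation free := {malg F[(M * N)%type]}.
Local Notation pure m n := (<< ((m, n) : (M * N)%type) >> : free).

Definition bilinear_relations : set free :=
  [set x | exists (a : F) (m m' : M) (n : N),
      x = pure (a *: m + m') n - (a *: pure m n + pure m' n)]
  `|` [set x | exists (a : F) (m : M) (n n' : N),
      x = pure m (a *: n + n') - (a *: pure m n + pure m n')].

Definition tensor : Type := quotmod bilinear_relations.
HB.instance Definition _ := GRing.Lmodule.on tensor.

Definition tens (m : M) (n : N) : tensor := qproj _ (pure m n).

Definition tmap_free (f : M -> M) (g : N -> N) (u : free) : tensor :=
  \sum_(k <- msupp u) u@_k *: tens (f k.1) (g k.2).

(* For linear f and g this is the map f (x) g, see tmap_tens. *)
Definition tmap (f : M -> M) (g : N -> N) (t : tensor) : tensor :=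
  tmap_free f g (qrepr bilinear_relations t).

Lemma tens_linearl a m m' n :
  tens (a *: m + m') n = a *: tens m n + tens m' n.
Proof.
rewrite /tens -linearP; apply/eqP; rewrite qproj_eq.
by apply: spanp_sub; left; exists a, m, m', n.
Qed.

Lemma tens_linearr a m n n' :
  tens m (a *: n + n') = a *: tens m n + tens m n'.
Proof.
rewrite /tens -linearP; apply/eqP; rewrite qproj_eq.
by apply: spanp_sub; right; exists a, m, n, n'.
Qed.

Lemma tmap_freeEw f g (d : {fset (M * N)%type}) u : (msupp u `<=` d)%fset ->
  tmap_free f g u = \sum_(k <- d) u@_k *: tens (f k.1) (g k.2).
Proof.
move=> le; rewrite /tmap_free (big_fset_incl _ le) //= => k _ /mcoeff_outdom ->.
by rewrite scale0r.
Qed.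

Lemma tmap_freeU f g m n : tmap_free f g (pure m n) = tens (f m) (g n).
Proof. by rewrite (tmap_freeEw _ _ msuppU_le) big_seq_fset1 mcoeffUU scale1r. Qed.

Lemma tmap_free_linear f g : linear (tmap_free f g).
Proof.
move=> a u v; set d := (msupp (a *: u + v) `|` msupp u `|` msupp v)%fset.
rewrite 3?(@tmap_freeEw f g d); first last.
- by rewrite /d -fsetUA fsubsetUl.
- by rewrite /d -fsetUA fsubsetU // fsubsetUl orbT.
- by rewrite /d fsubsetUr.
rewrite scaler_sumr -big_split; apply: eq_bigr => k _ /=.
by rewrite mcoeffD mcoeffZ scalerDl scalerA.
Qed.

Lemma tmap_qproj f g : linear f -> linear g ->
  forall u, tmap f g (qproj _ u) = tmap_free f g u.
Proof.
move=> lf lg u; have lt := tmap_free_linear f g.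
have t0 : tmap_free f g 0 = 0 by have := lt (-1) 0 0; rewrite scaler0 addr0 scaleN1r addNr.
have tB x y : tmap_free f g (x - y) = tmap_free f g x - tmap_free f g y.
  by rewrite addrC -scaleN1r lt scaleN1r addrC.
apply/eqP; rewrite -subr_eq0 -tB; apply/eqP.
apply: (spanp_min (S := [set x | tmap_free f g x = 0])) (qreprP _ u).
  by split=> [|a x y Sx Sy]; [exact: t0 | rewrite /= lt Sx Sy scaler0 addr0].
move=> x [[a [m [m' [n ->]]]]|[a [m [n [n' ->]]]]] /=;
  rewrite tB lt !tmap_freeU.
  by rewrite lf tens_linearl subrr.
by rewrite lg tens_linearr subrr.
Qed.

Lemma tmap_linear f g : linear f -> linear g -> linear (tmap f g).
Proof.
move=> lf lg a x y; rewrite -[x]qreprK -[y]qreprK -linearP !tmap_qproj //.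
exact: tmap_free_linear.
Qed.

Lemma tmap_tens f g m n : linear f -> linear g ->
  tmap f g (tens m n) = tens (f m) (g n).
Proof. by move=> lf lg; rewrite tmap_qproj // tmap_freeU. Qed.

End TensorProduct.

Section QuotientAlgebra.
Variables (F : comNzRingType) (A : algType F) (G : set A).

(* The linear span of this set is the two-sided ideal generated by G. *)
Definition ideal_gens : set A :=
  [set z | exists (u g v : A), G g /\ z = u * g * v].

Definition quotalg : Type := quotmod ideal_gens.
HB.instance Definition _ := GRing.Lmodule.on quotalg.

Definition aproj : A -> quotalg := qproj ideal_gens.
Definition aone : quotalg := aproj 1.
Definition amul (x y : quotalg) : quotalg :=
  aproj (qrepr ideal_gens x * qrepr ideal_gens y).

Lemma ideal_gensMl u v : v \in spanp ideal_gens -> u * v \in spanp ideal_gens.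
Proof.
apply: (spanp_min (S := [set v | u * v \in spanp ideal_gens])).
  split=> [|a x y Sx Sy]; rewrite /mkset; first by rewrite mulr0; apply: spanp0.
  by rewrite mulrDr -scalerAr; apply: spanp_lin.
move=> _ [x [g [y [rg ->]]]].
by apply: spanp_sub; exists (u * x), g, y; rewrite !mulrA.
Qed.

Lemma ideal_gensMr u v : v \in spanp ideal_gens -> v * u \in spanp ideal_gens.
Proof.
apply: (spanp_min (S := [set v | v * u \in spanp ideal_gens])).
  split=> [|a x y Sx Sy]; rewrite /mkset; first by rewrite mul0r; apply: spanp0.
  by rewrite mulrDl -scalerAl; apply: spanp_lin.
move=> _ [x [g [y [rg ->]]]].
by apply: spanp_sub; exists x, g, (y * u); rewrite !mulrA.
Qed.

Lemma amulE u v : amul (aproj u) (aproj v) = aproj (u * v).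
Proof.
apply/eqP; rewrite qproj_eq.
set u' := qrepr _ _; set v' := qrepr _ _.
have -> : u' * v' - u * v = u' * (v' - v) + (u' - u) * v.
  by rewrite mulrBr mulrBl addrA subrK.
by apply: spanpD; [apply: ideal_gensMl | apply: ideal_gensMr]; apply: qreprP.
Qed.

Lemma aprojK (x : quotalg) : aproj (qrepr ideal_gens x) = x.
Proof. exact: qreprK. Qed.
Lemma aprojD u v : aproj (u + v) = aproj u + aproj v.
Proof. exact: raddfD. Qed.
Lemma aprojZ a u : aproj (a *: u) = a *: aproj u.
Proof. exact: linearZ. Qed.

Lemma amulA : associative amul.
Proof.
by move=> x y z; rewrite -(aprojK x) -(aprojK y) -(aprojK z) !amulE mulrA.
Qed.
Lemma amul1l : left_id aone amul.
Proof. by move=> x; rewrite -(aprojK x) amulE mul1r. Qed.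
Lemma amul1r : right_id aone amul.
Proof. by move=> x; rewrite -(aprojK x) amulE mulr1. Qed.
Lemma amulDl : left_distributive amul +%R.
Proof.
move=> x y z; rewrite -(aprojK x) -(aprojK y) -(aprojK z).
by rewrite -aprojD !amulE mulrDl aprojD.
Qed.
Lemma amulDr : right_distributive amul +%R.
Proof.
move=> x y z; rewrite -(aprojK x) -(aprojK y) -(aprojK z).
by rewrite -aprojD !amulE mulrDr aprojD.
Qed.

(* Only a possibly trivial ring, since the ideal need not be proper. *)
HB.instance Definition _ := GRing.Zmodule_isPzRing.Build quotalg
  amulA amul1l amul1r amulDl amulDr.

Lemma aproj1 : aproj 1 = 1.
Proof. by []. Qed.
Lemma aprojM u v : aproj (u * v) = aproj u * aproj v.
Proof. by rewrite -amulE. Qed.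

Lemma quotalg_scaleAl a (x y : quotalg) : a *: (x * y) = a *: x * y.
Proof.
by rewrite -(aprojK x) -(aprojK y) -aprojM -!aprojZ -aprojM -scalerAl.
Qed.

Lemma quotalg_scaleAr a (x y : quotalg) : a *: (x * y) = x * (a *: y).
Proof.
by rewrite -(aprojK x) -(aprojK y) -aprojM -!aprojZ -aprojM -scalerAr.
Qed.

(* The quotient of quotalg by the left ideal generated by L. *)
Section LeftIdeal.
Variable L : set quotalg.

Definition left_ideal_gens : set quotalg :=
  [set z | exists u g : quotalg, L g /\ z = u * g].

Definition leftquot : Type := quotmod left_ideal_gens.
HB.instance Definition _ := GRing.Lmodule.on leftquot.

Definition lact (u : quotalg) (m : leftquot) : leftquot :=
  qproj left_ideal_gens (u * qrepr left_ideal_gens m).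

Lemma lactE u v : lact u (qproj _ v) = qproj _ (u * v).
Proof.
apply/eqP; rewrite qproj_eq -mulrBr; move: (qreprP left_ideal_gens v).
apply: (spanp_min (S := [set v | u * v \in spanp left_ideal_gens])).
  split=> [|a x y Sx Sy]; rewrite /mkset; first by rewrite mulr0; apply: spanp0.
  by rewrite mulrDr -quotalg_scaleAr; apply: spanp_lin.
move=> _ [x [g [Lg ->]]].
by apply: spanp_sub; exists (u * x), g; rewrite mulrA.
Qed.

Lemma lact_linear u : linear (lact u).
Proof.
move=> a x y; rewrite -[x]qreprK -[y]qreprK -linearP !lactE -linearP.
by rewrite mulrDr quotalg_scaleAr.
Qed.

End LeftIdeal.
End QuotientAlgebra.

Section FreeAlgebra.
Variables (F : comNzRingType) (X : choiceType).

Lemma freealg_scaleAr a (u v : {malg F[{fmonom X}]}) :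
  a *: (u * v) = u * (a *: v).
Proof.
have aC : a%:MP * u = u * a%:MP.
  rewrite !malgM_def fgmulUg fgmulgU; apply: eq_bigr => k _.
  by rewrite mul1m mulm1 mulrC.
rewrite -mul_malgC -[in RHS]mul_malgC (mulrA (_%:MP)) aC -mulrA.
reflexivity.
Qed.

Definition freealg : Type := {malg F[{fmonom X}]}.
HB.instance Definition _ := GRing.Lalgebra.on freealg.

HB.instance Definition _ := GRing.Lalgebra_isAlgebra.Build F freealg
  freealg_scaleAr.

Definition var (x : X) : freealg := << fmu x >>.

End FreeAlgebra.

(* The unital associative algebra generated by X with the relations
   x y - y x = c x y, where the c x y are scalars. *)
Section CCRAlgebra.
Variables (F : comNzRingType) (X : choiceType) (c : X -> X -> F).

Definition ccr_relations : set (freealg F X) :=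
  [set g | exists x y : X,
     g = var F x * var F y - var F y * var F x - (c x y)%:A].

Definition ccr : Type := quotalg ccr_relations.
HB.instance Definition _ := GRing.PzRing.on ccr.
HB.instance Definition _ := GRing.Lmodule.on ccr.

Definition gen (x : X) : ccr := aproj ccr_relations (var F x).

(* The quotient of the algebra by the left ideal generated by the elements
   x - chi x with x in D. *)
Variables (D : set X) (chi : X -> F).

Definition whit_relations : set ccr :=
  [set z | exists x : X, D x /\ z = gen x - chi x *: (1 : ccr)].

Definition whit : Type := leftquot whit_relations.
HB.instance Definition _ := GRing.Lmodule.on whit.

Definition whit_vec : whit := qproj (left_ideal_gens whit_relations) 1.
Definition wact (u : ccr) : whit -> whit := lact u.

End CCRAlgebra.

(* sl2[t, t^-1] + F K, with basis x(n) = mode x n and K. *)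
Inductive sl2_basis := SE | SH | SF.

Definition sl2_basis_code x : option bool :=
  match x with SE => Some true | SH => None | SF => Some false end.
Definition sl2_basis_decode (i : option bool) : sl2_basis :=
  match i with Some true => SE | None => SH | Some false => SF end.
Lemma sl2_basis_codeK : cancel sl2_basis_code sl2_basis_decode.
Proof. by case. Qed.
HB.instance Definition _ := Countable.copy sl2_basis (can_type sl2_basis_codeK).

Section AffineSl2.
Variable F : comNzRingType.

(* The bracket of two basis vectors of sl2, computed in a vector space
   spanned by a copy b SE, b SH, b SF of the basis. *)
Definition sl2_bracket (V : lmodType F) (b : sl2_basis -> V) x y : V :=
  match x, y with
  | SE, SF => b SH        | SF, SE => - b SH
  | SH, SE => 2 *: b SE   | SE, SH => - (2 *: b SE)
  | SH, SF => - (2 *: b SF) | SF, SH => 2 *: b SF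
  | _, _ => 0
  end.

Definition sl2_form x y : F :=
  match x, y with SE, SF | SF, SE => 1 | SH, SH => 2 | _, _ => 0 end.

(* None is the central element K and Some (x, n) is x(n). *)
Definition affine_basis := option (sl2_basis * int).
HB.instance Definition _ := Choice.on affine_basis.

Definition affine : Type := {malg F[affine_basis]}.
HB.instance Definition _ := GRing.Lmodule.on affine.

Definition mode x n : affine := << (Some (x, n) : affine_basis) >>.
Definition Kc : affine := << (None : affine_basis) >>.

Definition bracket_basis (s t : affine_basis) : affine :=
  match s, t with
  | Some (x, n), Some (y, m) =>
      sl2_bracket (fun z => mode z (n + m)) x y
      + (n%:~R * sl2_form x y * (n + m == 0)%:R) *: Kc
  | _, _ => 0
  end.

Definition bracket (u v : affine) : affine :=
  \sum_(s <- msupp u) \sum_(t <- msupp v) (u@_s * v@_t) *: bracket_basis s t.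

(* x(n) for the element x of sl2 with coordinates c. *)
Definition sl2_mode (c : sl2_basis -> F) (n : int) : affine :=
  c SE *: mode SE n + c SH *: mode SH n + c SF *: mode SF n.

(* Modules over the universal affine vertex algebra of level kappa, that is,
   smooth modules of level kappa over the affine Lie algebra. *)
Definition smooth_module (kappa : F) (V : lmodType F)
    (rho : affine -> V -> V) : Prop :=
  [/\ forall x, linear (rho x),
      forall v, linear (rho^~ v),
      forall x y v, rho (bracket x y) v = rho x (rho y v) - rho y (rho x v),
      forall v, rho Kc v = kappa *: v
    & forall v (c : sl2_basis -> F), exists n0 : int,
        forall n : int, (n0 <= n)%O -> rho (sl2_mode c n) v = 0].

(* The submodule U(affine) w generated by w. *)
Section CyclicSubmodule.
Variables (V : lmodType F) (rho : affine -> V -> V) (w : V).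

Definition cyclic : {pred V} :=
  fun v => `[< forall S : set V, subspace S ->
                 (forall x u, S u -> S (rho x u)) -> S w -> S v >].

Lemma cyclic_submod : submod_closed cyclic.
Proof.
split=> [|a u v /asboolP Gu /asboolP Gv]; apply/asboolP => S mS GS Sw.
  by case: mS.
by apply: mS.2; [apply: Gu | apply: Gv].
Qed.
HB.instance Definition _ :=
  GRing.isSubmodClosed.Build F V cyclic cyclic_submod.

Lemma cyclic_stable x v : v \in cyclic -> rho x v \in cyclic.
Proof.
move=> /asboolP Gv; apply/asboolP=> S mS GS Sw.
exact: (GS x v (Gv S mS GS Sw)).
Qed.

Lemma cyclic_gen : w \in cyclic.
Proof. by apply/asboolP => S _ _. Qed.

Definition cyclic_submodule : Type := {v | v \in cyclic}.
HB.instance Definition _ := SubChoice.on cyclic_submodule.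
HB.instance Definition _ := [SubChoice_isSubLmodule of cyclic_submodule by <:].

Definition cyclic_vec : cyclic_submodule := exist _ w cyclic_gen.
Definition cyclic_act (x : affine) (v : cyclic_submodule) : cyclic_submodule :=
  exist _ (rho x (val v)) (cyclic_stable x (valP v)).

End CyclicSubmodule.

Arguments cyclic_vec {V} rho w.
Arguments cyclic_act {V} rho w x v.

(* The Lie subalgebra P_{q,r}. *)
Section Pqr.
Variables q r : nat.

Definition Pqr_gens : set affine :=
  [set x | [\/ x = Kc,
              exists n : nat, x = mode SE n,
              exists m : nat, (q <= m)%N /\ x = mode SH m
            | exists p : nat, (r <= p)%N /\ x = mode SF p]].

Definition Pqr_pred : {pred affine} :=
  fun x => `[< forall S : set affine, subspace S ->
                 (forall u v, S u -> S v -> S (bracket u v)) ->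
                 Pqr_gens `<=` S -> S x >].

Lemma Pqr_submod : submod_closed Pqr_pred.
Proof.
split=> [|a u v /asboolP Gu /asboolP Gv]; apply/asboolP => S mS bS GS.
  by case: mS.
by apply: mS.2; [apply: Gu | apply: Gv].
Qed.
HB.instance Definition _ :=
  GRing.isSubmodClosed.Build F affine Pqr_pred Pqr_submod.

Lemma Pqr_bracket_closed x y :
  x \in Pqr_pred -> y \in Pqr_pred -> bracket x y \in Pqr_pred.
Proof.
move=> /asboolP Px /asboolP Py; apply/asboolP=> S mS bS GS.
exact: (bS x y (Px S mS bS GS) (Py S mS bS GS)).
Qed.

Lemma Pqr_gen x : Pqr_gens x -> x \in Pqr_pred.
Proof. by move=> Gx; apply/asboolP=> S _ _; apply. Qed.

Definition Pqr : Type := {x | x \in Pqr_pred}.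
HB.instance Definition _ := SubChoice.on Pqr.
HB.instance Definition _ := [SubChoice_isSubLmodule of Pqr by <:].

Definition Pqr_bracket (x y : Pqr) : Pqr :=
  exist _ (bracket (val x) (val y)) (Pqr_bracket_closed (valP x) (valP y)).

Lemma PK_proof : Kc \in Pqr_pred.
Proof. by apply: Pqr_gen; constructor 1. Qed.
Lemma Pe_proof (i : nat) : mode SE i \in Pqr_pred.
Proof. by apply: Pqr_gen; constructor 2; exists i. Qed.
Lemma Ph_proof (i : nat) : mode SH (q + i)%N \in Pqr_pred.
Proof. by apply: Pqr_gen; constructor 3; exists (q + i)%N; rewrite leq_addr. Qed.
Lemma Pf_proof (i : nat) : mode SF (r + i)%N \in Pqr_pred.
Proof. by apply: Pqr_gen; constructor 4; exists (r + i)%N; rewrite leq_addr. Qed.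

(* K, e(i), h(q + i) and f(r + i) as elements of P_{q,r}. *)
Definition PK : Pqr := exist _ Kc PK_proof.
Definition Pe (i : nat) : Pqr := exist _ (mode SE i) (Pe_proof i).
Definition Ph (i : nat) : Pqr := exist _ (mode SH (q + i)%N) (Ph_proof i).
Definition Pf (i : nat) : Pqr := exist _ (mode SF (r + i)%N) (Pf_proof i).

(* Lie algebra homomorphisms from P_{q,r} to the abelian Lie algebra F. *)
Definition lie_character (psi : Pqr -> F) : Prop :=
  (forall a x y, psi (a *: x + y) = a * psi x + psi y) /\
  (forall x y, psi (Pqr_bracket x y) = 0).

Definition whittaker_vector (psi : Pqr -> F) (V : lmodType F)
    (rho : affine -> V -> V) (v : V) : Prop :=
  forall x : Pqr, rho (val x) v = psi x *: v.

Definition generalized_whittaker_module (kappa : F) (psi : Pqr -> F)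
    (V : lmodType F) (rho : affine -> V -> V) (v : V) : Prop :=
  [/\ smooth_module kappa rho,
      lie_character psi /\ psi PK = kappa,
      v != 0,
      whittaker_vector psi rho v
    & forall u, u \in cyclic rho v].

End Pqr.
End AffineSl2.

Arguments cyclic_vec {F V} rho w.
Arguments cyclic_act {F V} rho w x v.
Arguments PK {F} q r.
Arguments Pe {F} q r i.
Arguments Ph {F} q r i.
Arguments Pf {F} q r i.

Inductive weyl_gen := Wa of int | Was of int.

Definition weyl_gen_code x : int + int :=
  match x with Wa n => inl n | Was n => inr n end.
Definition weyl_gen_decode (x : int + int) : weyl_gen :=
  match x with inl n => Wa n | inr n => Was n end.
Lemma weyl_gen_codeK : cancel weyl_gen_code weyl_gen_decode.
Proof. by case. Qed.
HB.instance Definition _ := Countable.copy weyl_gen (can_type weyl_gen_codeK).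

Section Wakimoto.
Variable F : comNzRingType.

(* [a(n), a^*(m)] = delta_{n+m,0}. *)
Definition weyl_comm (x y : weyl_gen) : F :=
  match x, y with
  | Wa n, Was m => (n + m == 0)%:R
  | Was m, Wa n => - (n + m == 0)%:R
  | _, _ => 0
  end.

Definition weyl : Type := ccr weyl_comm.
HB.instance Definition _ := GRing.PzRing.on weyl.
HB.instance Definition _ := GRing.Lmodule.on weyl.

(* The annihilators of the vacuum: a(n), n >= 0, and a^*(n), n >= 1. *)
Definition annihilator (x : weyl_gen) : bool :=
  match x with Wa n => (0 <= n)%O | Was n => (1 <= n)%O end.

(* The normally ordered product of a word in the generators. *)
Definition normal_order (s : seq weyl_gen) : weyl :=
  \prod_(x <- [seq x <- s | ~~ annihilator x] ++ [seq x <- s | annihilator x])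
     gen weyl_comm x.

(* mu 0 plays no role in M1. *)
Definition M1_char (lam mu : nat -> F) (x : weyl_gen) : F :=
  match x with Wa n => lam `|n|%N | Was n => mu `|n|%N end.
Definition M1 (lam mu : nat -> F) : Type :=
  whit weyl_comm annihilator (M1_char lam mu).
HB.instance Definition _ lam mu := GRing.Lmodule.on (M1 lam mu).
Definition M1_vec lam mu : M1 lam mu := whit_vec _ _ _.
Definition M1_act lam mu (u : weyl) : M1 lam mu -> M1 lam mu := wact u.

Variable kappa : F.

Definition heis_comm (n m : int) : F :=
  2 * (kappa + 2) * n%:~R * (n + m == 0)%:R.

Definition N1 (eta : nat -> F) : Type :=
  whit heis_comm (fun n : int => (0 <= n)%O) (fun n => eta `|n|%N).
HB.instance Definition _ eta := GRing.Lmodule.on (N1 eta).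
Definition N1_vec eta : N1 eta := whit_vec _ _ _.
Definition N1_act eta (n : int) : N1 eta -> N1 eta := wact (gen heis_comm n).

(* The Wakimoto action on a tensor product of a module over the Weyl algebra
   and a module over the Heisenberg algebra. *)
Section Action.
Variables (V W : lmodType F) (act_weyl : weyl -> V -> V)
  (act_heis : int -> W -> W).

Local Notation T := (tensor V W).

Definition weyl_act (u : weyl) : T -> T := tmap (act_weyl u) id.
Definition heis_act (n : int) : T -> T := tmap id (act_heis n).

(* The coefficients of z^(-n-1) in the Wakimoto formulas.  On each vector of
   M1 (x) N1 only
   finitely many terms of the sums over int and int * int are nonzero, and
   \sum_(k \in setT) is the sum over the support. *)
Definition wak_e (n : int) (t : T) : T := weyl_act (gen weyl_comm (Wa n)) t.

Definition wak_h (n : int) (t : T) : T :=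
  - (2 *: \sum_(k \in [set: int])
            weyl_act (normal_order [:: Was k; Wa (n - k)]) t)
  + heis_act n t.

Definition wak_f (n : int) (t : T) : T :=
  - (\sum_(k \in [set: int * int])
       weyl_act (normal_order [:: Was k.1; Was k.2; Wa (n - k.1 - k.2)]) t)
  + (kappa * (- n)%:~R) *: weyl_act (gen weyl_comm (Was n)) t
  + (\sum_(k \in [set: int])
       weyl_act (gen weyl_comm (Was k)) (heis_act (n - k) t)).

Definition wakimoto_basis (s : affine_basis) (t : T) : T :=
  match s with
  | None => kappa *: t
  | Some (SE, n) => wak_e n t
  | Some (SH, n) => wak_h n t
  | Some (SF, n) => wak_f n t
  end.

Definition wakimoto_act (x : affine F) (t : T) : T :=
  \sum_(s <- msupp x) x@_s *: wakimoto_basis s t.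

End Action.

Variables lam mu eta : nat -> F.

Definition wakimoto := wakimoto_act (@M1_act lam mu) (@N1_act eta).
Definition wakimoto_vec := tens (M1_vec lam mu) (N1_vec eta).

End Wakimoto.

Arguments wakimoto {F} kappa lam mu eta x t.
Arguments wakimoto_vec {F} kappa lam mu eta.

(* Main.v *)
(* Only local finiteness and single commutators are used. Call a family of
   operators X(n), n in Z, a field if X(n)t = 0 for n large, and let
   :XY:_j(m) = sum_(k < j) X(k)Y(m-k) + sum_(k >= j) Y(m-k)X(k). If [D,
   X(p)] = X'(n+p) and [D, Y(p)] = Y'(n+p), then [D, :XY:_0(m)] =
   :X'Y:_n(n+m) + :XY':_0(n+m), and moving the cut of the first term from n
   back to 0 costs n times the contraction of X' with Y; this produces every
   anomaly coming from a and a*. With a* a = :a a*:, a*^2 a = :a (:a* a*:):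
   all brackets of e, h, f follow. For [f(n), f(m)] the explicit dependence
   on n cancels, so the bracket depends on n + m only, and being
   antisymmetric it vanishes: the double contractions never have to be
   computed. The vector w is an eigenvector of the modes generating P_{q,r},
   and it is non-zero because a Fock module provides a linear form on each
   factor taking the value 1 on the vacuum. *)

Require Import Defs.
From HB Require Import structures.
From mathcomp Require Import all_boot all_order all_algebra.
From mathcomp Require Import reals complex.
From mathcomp Require Import boolp classical_sets fsbigop finmap.
From mathcomp.multinomials Require Import monalg.
From mathcomp Require Import zify ring.

Set Implicit Arguments.
Unset Strict Implicit.
Unset Printing Implicit Defensive.

Import Order.TTheory GRing.Theory Num.Theory.
Local Open Scope ring_scope.

(** Two choices shape the proof. Normally ordered products are expanded in the index of a, so that
    one cut stands for the separate vacuum prescriptions of a and a*, and nested products obey the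
    same commutator rule as simple ones. And the modules are given by generators and relations,
    hence without a basis: identities are checked on spanning vectors, while non-vanishing has to
    come from a map out of the quotient. The constant 2(kappa + 2) is what makes the anomalies fit:
    the Heisenberg contraction offsets the contractions of a with a*, and the level kappa remains.
    Nothing is divided by kappa + 2, so the critical level is included. The action of a*(0) on w is
    not prescribed. Besides the truncation of the sequences, this dictates q and r: every term
    containing a*(0) must have another factor that kills w. The function psi is not built from its
    prescribed values, which would require a description of P_{q,r}. It is the eigenvalue on w, and
    it vanishes on brackets because scalars commute. *)

(** * Reflection of linear combinations in a module *)

Inductive lexpr (F : Type) :=
  | LVar of nat | LZero | LAdd of lexpr F & lexpr F | LOpp of lexpr F
  | LScale of F & lexpr F.
Arguments LVar {F} _.
Arguments LZero {F}.

Section LinearExpressions.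
Variables (F : comNzRingType) (T : lmodType F).

Fixpoint leval (env : seq T) (e : lexpr F) : T :=
  match e with
  | LVar i => nth 0 env i
  | LZero => 0
  | LAdd e1 e2 => leval env e1 + leval env e2
  | LOpp e1 => - leval env e1
  | LScale a e1 => a *: leval env e1
  end.

(** The test [eqn] reduces on numerals, so that unfolding leaves purely scalar equations for
    [ring]. *)
Fixpoint lcoef (e : lexpr F) (i : nat) : F :=
  match e with
  | LVar j => if eqn i j then 1 else 0
  | LZero => 0
  | LAdd e1 e2 => lcoef e1 i + lcoef e2 i
  | LOpp e1 => - lcoef e1 i
  | LScale a e1 => a * lcoef e1 i
  end.

Lemma lcoef_var j i : lcoef (LVar j) i = (i == j)%:R.
Proof. by rewrite /lcoef eqnE; case: eqP. Qed.

Lemma levalE env e :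
  leval env e = \sum_(i < size env) lcoef e i *: nth 0 env i.
Proof.
elim: e => [j||e1 IH1 e2 IH2|e IH|a e IH]; rewrite [LHS]/=.
- under eq_bigr do rewrite lcoef_var.
  have [jn|nj] := ltnP j (size env).
    rewrite (bigD1 (Ordinal jn)) //= eqxx scale1r big1 ?addr0// => i ij.
    by rewrite (_ : (i == j :> nat) = false) ?scale0r//; apply/negbTE.
  rewrite nth_default// big1// => i _.
  by rewrite (_ : (i == j :> nat) = false) ?scale0r//; move: (ltn_ord i); lia.
- by rewrite big1// => i _; rewrite scale0r.
- by rewrite IH1 IH2 -big_split; apply: eq_bigr => i _; rewrite scalerDl.
- by rewrite IH -sumrN; apply: eq_bigr => i _; rewrite scaleNr.
- by rewrite IH scaler_sumr; apply: eq_bigr => i _; rewrite scalerA.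
Qed.

Fixpoint lcoef_eq (e1 e2 : lexpr F) n : Prop :=
  if n is n'.+1 then lcoef e1 n' = lcoef e2 n' /\ lcoef_eq e1 e2 n' else True.

Lemma leval_eq env e1 e2 :
  lcoef_eq e1 e2 (size env) -> leval env e1 = leval env e2.
Proof.
move=> e12; rewrite !levalE; apply: eq_bigr => i _; congr (_ *: _).
case: i => i /=; elim: (size _) e12 => //= n IH [en /IH {}IH].
by rewrite ltnS leq_eqVlt => /predU1P[->//|/IH].
Qed.

End LinearExpressions.

(* [lmod] proves an equality of linear combinations by comparing the
   coefficients of syntactically equal atoms with [ring]. *)
Ltac lmod_mem x l :=
  lazymatch l with
  | nil => constr:(false)
  | x :: _ => constr:(true)
  | _ :: ?l' => lmod_mem x l'
  end.
Ltac lmod_atoms t l :=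
  lazymatch t with
  | GRing.zero => l
  | GRing.add ?a ?b => let l' := lmod_atoms a l in lmod_atoms b l'
  | GRing.opp ?a => lmod_atoms a l
  | GRing.scale _ ?a => lmod_atoms a l
  | _ => lazymatch lmod_mem t l with
         | true => l
         | false => constr:(t :: l)
         end
  end.
Ltac lmod_index x l :=
  lazymatch l with
  | x :: _ => constr:(0%N)
  | _ :: ?l' => let n := lmod_index x l' in constr:(S n)
  end.
Ltac lmod_reify F t l :=
  lazymatch t with
  | GRing.zero => constr:(@LZero F)
  | GRing.add ?a ?b =>
      let x := lmod_reify F a l in let y := lmod_reify F b l in
      constr:(@LAdd F x y)
  | GRing.opp ?a => let x := lmod_reify F a l in constr:(@LOpp F x)
  | GRing.scale ?c ?a =>
      let x := lmod_reify F a l in constr:(@LScale F c x)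
  | _ => let n := lmod_index t l in constr:(@LVar F n)
  end.
Ltac lmod F :=
  lazymatch goal with
  | |- @eq ?T ?u ?v =>
    let l0 := lmod_atoms u (@nil T) in
    let l := lmod_atoms v l0 in
    let x := lmod_reify F u l in
    let y := lmod_reify F v l in
    apply: (@leval_eq F _ l x y); cbn [lcoef_eq size lcoef eqn];
    repeat apply: conj; try exact: I; try by ring
  end.

(** * Sums over families of finite support *)

Section FiniteSums.
Variables (F : comNzRingType) (T : lmodType F) (I : choiceType).
Implicit Types g h : I -> T.

Definition finsum g : T := \sum_(i \in [set: I]) g i.

(** The sum over [[set: I]] is 0 by convention when the support is infinite, so that additivity has
    to be conditioned on this. *)
Definition finsupported g : Prop :=
  exists A : {fset I}, forall i, i \notin A -> g i = 0.

Lemma finsumE g (A : {fset I}) :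
  (forall i, i \notin A -> g i = 0) -> finsum g = \sum_(i <- A) g i.
Proof. exact: fsbigTE. Qed.

Lemma eq_finsum g h : g =1 h -> finsum g = finsum h.
Proof. by move=> gh; apply: eq_fsbigr => i _; apply: gh. Qed.

Lemma finsumD g h : finsupported g -> finsupported h ->
  finsum (fun i => g i + h i) = finsum g + finsum h.
Proof.
move=> [A gA] [B hB].
rewrite !(@finsumE _ (A `|` B)%fset) ?big_split//= => i;
  by rewrite inE negb_or => /andP[iA iB]; rewrite ?gA ?hB ?addr0.
Qed.

Lemma finsum_linear (f : {linear T -> T}) g : finsupported g ->
  f (finsum g) = finsum (fun i => f (g i)).
Proof.
move=> [A gA]; rewrite !(@finsumE _ A) ?linear_sum// => i iA.
by rewrite gA// linear0.
Qed.

Lemma finsupportedZ a g : finsupported g -> finsupported (fun i => a *: g i).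
Proof. by move=> [A gA]; exists A => i /gA ->; rewrite scaler0. Qed.

Lemma finsumZ a g : finsupported g ->
  finsum (fun i => a *: g i) = a *: finsum g.
Proof.
move=> [A gA]; rewrite !(@finsumE _ A) ?scaler_sumr// => i iA.
by rewrite gA// scaler0.
Qed.

(** Writes a single vector as a sum, so that a correction term can be compared with a normally
    ordered product summand by summand. *)
Lemma finsum_single (j : I) (u : T) :
  finsum (fun i => if i == j then u else 0) = u.
Proof.
rewrite (@finsumE _ [fset j]%fset) ?big_seq_fset1 ?eqxx// => i.
by rewrite inE => /negbTE ->.
Qed.

Lemma finsupported_single (j : I) (u : T) :
  finsupported (fun i => if i == j then u else 0).
Proof. by exists [fset j]%fset => i; rewrite inE => /negbTE ->. Qed.

Lemma finsum_reindex (J : choiceType) (h : J -> I) g :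
  bijective h -> finsum g = \sum_(j \in [set: J]) g (h j).
Proof. exact: reindex_fsbigT. Qed.

End FiniteSums.

Section IntegerSums.
Variables (F : comNzRingType) (T : lmodType F).
Implicit Types g h : int -> T.

Lemma mem_int_interval (lo hi k : int) :
  (lo <= k)%O -> (k < hi)%O ->
  k \in [fset (lo + i%:Z)%R | i in iota 0 `|hi - lo|%N]%fset.
Proof.
move=> lok khi; apply/imfsetP; exists `|k - lo|%N; rewrite /= ?mem_iota; lia.
Qed.

Lemma finsupported_int g (lo hi : int) :
  (forall k, (k < lo)%O -> g k = 0) -> (forall k, (hi <= k)%O -> g k = 0) ->
  finsupported g.
Proof.
move=> glo ghi; exists [fset (lo + i%:Z)%R | i in iota 0 `|hi - lo|%N]%fset => k kA.
have [/glo//|lok] := ltP k lo; have [/ghi//|khi] := leP hi k.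
by rewrite (mem_int_interval lok khi) in kA.
Qed.

Lemma finsum_shift g (n : int) : finsum g = finsum (fun k => g (n + k)).
Proof.
by apply: finsum_reindex; exists (fun k => k - n) => k; lia.
Qed.

Lemma finsum_reflect g (n : int) : finsum g = finsum (fun k => g (n - k)).
Proof.
by apply: finsum_reindex; exists (fun k => n - k) => k; lia.
Qed.

Lemma finsum_nat g n :
  (forall k : int, ~~ ((0 <= k)%O && (k < n%:Z)%O) -> g k = 0) ->
  finsum g = \sum_(i < n) g i%:Z.
Proof.
move=> g0; rewrite /finsum (fsbigE [seq i%:Z | i <- iota 0 n])//.
- rewrite big_map -(big_mkord xpredT (fun i => g i%:Z)) /index_iota subn0.
  by apply: eq_bigl => i; rewrite in_setT.
- by rewrite map_inj_uniq ?iota_uniq// => i j [].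
move=> k _ kA; apply: g0; apply: contra kA => /andP[k0 kn].
by apply/mapP; exists `|k|%N; rewrite ?mem_iota; lia.
Qed.

End IntegerSums.

(** * Fields and normally ordered products *)

(** Modes are indexed by degree, without the shift by conformal weight in the power of z. The
    indices of the factors of a product therefore add up exactly, for a and a* alike. *)
Record qfield (F : comNzRingType) (T : lmodType F) := QField {
  fmode :> int -> T -> T;
  fmode_linear : forall n, linear (fmode n);
  fmode_smooth : forall t, exists n0 : int,
    forall n, (n0 <= n)%O -> fmode n t = 0 }.

HB.instance Definition _ (F : comNzRingType) (T : lmodType F) (X : qfield T) n :=
  GRing.isLinear.Build F T T *:%R (fmode X n) (fmode_linear X n).

Section NormalOrdering.
Variables (F : comNzRingType) (T : lmodType F).
Implicit Types (X Y Z : qfield T) (t : T) (j n m : int).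

Lemma fieldD X n u v : X n (u + v) = X n u + X n v.
Proof. exact: linearD. Qed.

Lemma fieldZ X n a u : X n (a *: u) = a *: X n u.
Proof. exact: linearZ. Qed.

Lemma field_smooth2 X Y t : exists n0 : int,
  forall n, (n0 <= n)%O -> X n t = 0 /\ Y n t = 0.
Proof.
have [x Xx] := fmode_smooth X t; have [y Yy] := fmode_smooth Y t.
by exists (Num.max x y) => n nxy; split; [apply: Xx | apply: Yy]; lia.
Qed.

(** Smoothness is pointwise, so a common bound exists only for finitely many vectors. Such a finite
    window is what remains of a product once both tails are killed. *)
Lemma field_smooth_family X (u : int -> T) (lo hi : int) : exists n0 : int,
  forall n, (n0 <= n)%O -> forall k, (lo <= k)%O -> (k < hi)%O -> X n (u k) = 0.
Proof.
suff [n0 Xn0] : exists n0 : int, forall n, (n0 <= n)%O ->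
    forall i, (i < `|hi - lo|)%N -> X n (u (lo + i%:Z)) = 0.
  exists n0 => n nn0 k lok khi; have := Xn0 n nn0 `|k - lo|%N.
  have -> : lo + `|(k - lo)%R|%N%:Z = k by lia.
  by apply; lia.
elim: `|hi - lo|%N => [|d [n0 IH]]; first by exists 0.
have [n1 Xn1] := fmode_smooth X (u (lo + d%:Z)).
exists (Num.max n0 n1) => n nn i; rewrite ltnS leq_eqVlt => /predU1P[->|].
  by apply: Xn1; lia.
by apply: IH; lia.
Qed.

(* The modes below the cut [j] of the first factor count as creators; the
   usual normally ordered product is the case [j = 0]. *)
Definition nop_term j X Y m k t : T :=
  if (k < j)%O then X k (Y (m - k) t) else Y (m - k) (X k t).

Definition nop j X Y m t : T := finsum (fun k => nop_term j X Y m k t).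

Lemma nop_term_linear j X Y m k : linear (nop_term j X Y m k).
Proof. by move=> a u v; rewrite /nop_term; case: ifP => _; rewrite !linearP. Qed.

(** On each side of the cut the factor that acts first is the one whose index grows in that
    direction: [m - k] as k decreases, k as k increases. *)
Lemma finsupported_nop j X Y m t : finsupported (fun k => nop_term j X Y m k t).
Proof.
have [n0 XY0] := field_smooth2 X Y t.
apply: (@finsupported_int _ _ _ (Num.min j (m - n0)) (Num.max j n0)) => k kn;
  rewrite /nop_term; case: ifP => kj; try lia.
  by rewrite (XY0 _ _).2 ?linear0//; lia.
by rewrite (XY0 _ _).1 ?linear0//; lia.
Qed.

Lemma nop_linear j X Y m : linear (nop j X Y m).
Proof.
move=> a u v; rewrite /nop -finsumZ; last exact: finsupported_nop.
rewrite -finsumD; last exact: finsupported_nop.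
- by apply: eq_finsum => k; rewrite nop_term_linear.
- exact/finsupportedZ/finsupported_nop.
Qed.

Lemma nop_smooth j X Y t : exists n0 : int,
  forall n, (n0 <= n)%O -> nop j X Y n t = 0.
Proof.
have [n0 XY0] := field_smooth2 X Y t.
have [n1 XY1] := field_smooth_family Y (X ^~ t) j n0.
(* For k < j the index n - k is beyond [n0], for j <= k < [n0] it is beyond [n1], and for k >= [n0]
   already [X k t] vanishes. *)
exists (Num.max (n1 + n0) (n0 + j)) => n nn; rewrite /nop.
have -> : (fun k => nop_term j X Y n k t) = fun=> 0.
  apply: boolp.funext => k; rewrite /nop_term; case: ifPn => kj.
    by rewrite (XY0 _ _).2 ?linear0//; lia.
  have [n0k|kn0] := leP n0 k; first by rewrite (XY0 _ _).1 ?linear0//.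
  by rewrite XY1//; lia.
by rewrite /finsum fsbig1.
Qed.

Definition fnop X Y : qfield T :=
  QField (nop_linear 0 X Y) (nop_smooth 0 X Y).

(* Reindexing by the shift of modes moves the cut of the first term to [n]. *)
Lemma nop_commutator (D : {linear T -> T}) X Y X' Y' n m :
    (forall p t, D (X p t) = X p (D t) + X' (n + p) t) ->
    (forall p t, D (Y p t) = Y p (D t) + Y' (n + p) t) ->
  forall t, D (fnop X Y m t) =
    fnop X Y m (D t) + (nop n X' Y (n + m) t + nop 0 X Y' (n + m) t).
Proof.
move=> DX DY t; rewrite /= /nop finsum_linear; last exact: finsupported_nop.
rewrite (finsum_shift (fun k => nop_term n _ _ _ _ _) n).
rewrite -!finsumD; first last.
- exact: finsupported_nop.
- have [A HA] := finsupported_nop n X' Y (n + m) t.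
  exists [fset (k - n)%R | k in A]%fset => k kA; apply: HA.
  apply: contra kA => kA; apply/imfsetP; exists (n + k) => //; lia.
- have [A HA] := finsupported_nop 0 X Y' (n + m) t.
  have [B HB] := finsupported_nop n X' Y (n + m) t.
  exists ([fset (k - n)%R | k in B] `|` A)%fset => k.
  rewrite inE negb_or => /andP[kB kA]; rewrite HA// HB ?addr0//.
  apply: contra kB => kB; apply/imfsetP; exists (n + k) => //; lia.
- exact: finsupported_nop.
apply: eq_finsum => k; rewrite /nop_term.
have -> : n + m - (n + k) = m - k by lia.
have -> : n + m - k = n + (m - k) by lia.
have -> : (n + k < n)%O = (k < 0)%O by [lia].
case: ifP => _; rewrite ?DX ?DY ?DX ?linearD -?addrA//=.
  by congr (_ + _); rewrite addrC.
Qed.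

(** Only the summand k = j changes its order, and the commutator there has index j + (m - j) = m. *)
Lemma nop_cut_succ X Y (Z : int -> T -> T) j m t :
    (forall l k t, X l (Y k t) = Y k (X l t) + Z (l + k) t) ->
  nop (j + 1) X Y m t = nop j X Y m t + Z m t.
Proof.
move=> XY; rewrite -[Z m t](finsum_single j) /nop.
rewrite -finsumD; [|exact: finsupported_nop|exact: finsupported_single].
apply: eq_finsum => k; rewrite /nop_term.
have [->|kj] := eqVneq k j.
  rewrite ltxx; have -> : (j < j + 1)%O by [lia].
  by rewrite XY; congr (_ + Z _ t); lia.
by rewrite addr0; have -> : (k < j + 1)%O = (k < j)%O by [lia].
Qed.

(** The contraction depends on the sum of the indices only, so each unit move of the cut costs the
    same vector; negative cuts are reached by the same step read backwards. *)
Lemma nop_cut X Y (Z : int -> T -> T) j m t :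
    (forall l k t, X l (Y k t) = Y k (X l t) + Z (l + k) t) ->
  nop j X Y m t = fnop X Y m t + Z m t *~ j.
Proof.
move=> XY; elim/int_rect: j => [|j IH|j IH]; first by rewrite mulr0z addr0.
  have -> : j.+1%:Z = j%:Z + 1 by lia.
  by rewrite (nop_cut_succ _ _ _ XY) IH mulrzDr mulr1z addrA.
apply: (addIr (Z m t)); rewrite -(nop_cut_succ _ _ _ XY).
have -> : - (j.+1)%:Z + 1 = - j%:Z by lia.
rewrite IH -addrA -[X in _ + (_ + X)]mulr1z -mulrzDr; congr (_ + _ *~ _); lia.
Qed.

Lemma nop_comm X Y j m t :
    (forall l k t, X l (Y k t) = Y k (X l t)) ->
  nop j X Y m t = fnop X Y m t.
Proof.
move=> XY; rewrite (@nop_cut _ _ (fun _ _ => 0)) ?mul0rz ?addr0// => l k u.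
by rewrite XY addr0.
Qed.

(** Together with [fzero] this single constructor gives sums, multiples and opposites. It is closed
    transparently so that its modes compute. *)
Definition flin (a : F) X Y : qfield T.
Proof.
exists (fun n t => a *: X n t + Y n t).
  move=> n b u v; rewrite (fmode_linear X n) (fmode_linear Y n)
    !scalerDr !scalerA mulrC -!addrA.
  by congr (_ + _); rewrite addrCA.
move=> t; have [n0 XY] := field_smooth2 X Y t.
by exists n0 => n /XY[-> ->]; rewrite scaler0 addr0.
Defined.

Definition fzero : qfield T.
Proof.
exists (fun _ _ => 0) => [n a u v|t]; first by rewrite scaler0 addr0.
by exists 0.
Defined.

(** The identity regarded as a field: a scalar commutator delta_{n+m,0} becomes a mode of index n +
    m, as the commutator rule for products demands. *)
Definition fone : qfield T.
Proof.
exists (fun n t => (n == 0)%:R *: t) => [n a u v|t].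
  by rewrite scalerDr !scalerA mulrC.
by exists 1 => n n1; have -> : (n == 0) = false by [lia]; rewrite scale0r.
Defined.

(** For X = a* this is minus the derivative, since the coefficient of z^(-n-1) in the derivative of
    a*(z) is -n a*(n). *)
Definition feuler X : qfield T.
Proof.
exists (fun n t => n%:~R *: X n t) => [n a u v|t].
  by rewrite (fmode_linear X n) scalerDr !scalerA mulrC.
by have [n0 X0] := fmode_smooth X t; exists n0 => n /X0 ->; rewrite scaler0.
Defined.

Lemma nop_linl j a X1 X2 Y m t :
  nop j (flin a X1 X2) Y m t = a *: nop j X1 Y m t + nop j X2 Y m t.
Proof.
rewrite /nop -finsumZ; last exact: finsupported_nop.
rewrite -finsumD; last exact: finsupported_nop; last first.
  exact/finsupportedZ/finsupported_nop.
apply: eq_finsum => k; rewrite /nop_term/=.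
by case: ifP => _; rewrite ?linearP.
Qed.

Lemma nop_linr j a X Y1 Y2 m t :
  nop j X (flin a Y1 Y2) m t = a *: nop j X Y1 m t + nop j X Y2 m t.
Proof.
rewrite /nop -finsumZ; last exact: finsupported_nop.
rewrite -finsumD; last exact: finsupported_nop; last first.
  exact/finsupportedZ/finsupported_nop.
apply: eq_finsum => k; rewrite /nop_term/=.
by case: ifP => _; rewrite ?linearP.
Qed.

Lemma nop_zerol j Y m t : nop j fzero Y m t = 0.
Proof.
by rewrite /nop /finsum fsbig1// => k _; rewrite /nop_term/=; case: ifP => _;
  rewrite ?linear0.
Qed.

Lemma nop_zeror j X m t : nop j X fzero m t = 0.
Proof.
by rewrite /nop /finsum fsbig1// => k _; rewrite /nop_term/=; case: ifP => _;
  rewrite ?linear0.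
Qed.

Lemma nop_onel j Y m t : nop j fone Y m t = Y m t.
Proof.
rewrite -[RHS](finsum_single (0 : int)); apply: eq_finsum => k; rewrite /nop_term/=.
rewrite linearZ/= if_same; case: eqVneq => [->|_]; last by rewrite scale0r.
by rewrite subr0 scale1r.
Qed.

Lemma nop_oner j X m t : nop j X fone m t = X m t.
Proof.
rewrite -[RHS](finsum_single m); apply: eq_finsum => k; rewrite /nop_term/=.
rewrite linearZ/= if_same; case: (eqVneq k m) => [->|km].
  by rewrite subrr eqxx scale1r.
by rewrite subr_eq0 eq_sym (negbTE km) scale0r.
Qed.

End NormalOrdering.

Arguments nop_commutator {F T D X Y X' Y' n m} DX DY t.
Arguments nop_comm {F T X Y j m t} XY.
Arguments nop_cut {F T X Y} Z {j m t} XY.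

(** * Commutation relations of the Wakimoto fields *)

Section WakimotoFields.
Variables (F : comNzRingType) (T : lmodType F) (kappa : F) (A S b : qfield T).

Definition fcomm (X Y : qfield T) : Prop :=
  forall n m t, X n (Y m t) = Y m (X n t).

Hypotheses (AA : fcomm A A) (SS : fcomm S S) (Ab : fcomm A b) (Sb : fcomm S b)
  (AS : forall n m t, A n (S m t) = S m (A n t) + fone T (n + m) t)
  (bb : forall n m t, b n (b m t) =
    b m (b n t) + (2 * (kappa + 2) * n%:~R) *: fone T (n + m) t).

Let J := fnop A S.
Let S2 := fnop S S.
Let K := fnop A S2.
Let D := fnop S b.

Definition fwak_h : qfield T := flin (-2) J b.
Definition fwak_f : qfield T :=
  flin (-1) K (flin (- kappa) (feuler S) D).

Ltac wak_lmod := rewrite /J /K /D /S2 /=; lmod F.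

Lemma fcomm_nop X Y Z : fcomm X Y -> fcomm X Z -> fcomm X (fnop Y Z).
Proof.
move=> XY XZ n m t.
rewrite (nop_commutator (D := X n) (X' := fzero T) (Y' := fzero T) (n := n)).
- by rewrite nop_zerol nop_zeror !addr0.
- by move=> p u; rewrite [LHS]XY addr0.
- by move=> p u; rewrite [LHS]XZ addr0.
Qed.

Lemma fcommC X Y : fcomm X Y -> fcomm Y X.
Proof. by move=> XY n m t; rewrite XY. Qed.

Let SA n m t : S n (A m t) = A m (S n t) - fone T (n + m) t.
Proof. by rewrite AS [m + n]addrC addrK. Qed.

Let S_S2 : fcomm S S2. Proof. exact: fcomm_nop. Qed.
Let S2_S : fcomm S2 S. Proof. exact: fcommC. Qed.
Let b_S : fcomm b S. Proof. exact: fcommC. Qed.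
Let b_S2 : fcomm b S2. Proof. exact: fcomm_nop. Qed.
Let S2_b : fcomm S2 b. Proof. exact: fcommC. Qed.
Let b_A : fcomm b A. Proof. exact: fcommC. Qed.
Let b_J : fcomm b J. Proof. exact: fcomm_nop. Qed.
Let J_b : fcomm J b. Proof. exact: fcommC. Qed.
Let b_K : fcomm b K. Proof. exact: fcomm_nop. Qed.
Let K_b : fcomm K b. Proof. exact: fcommC. Qed.
Let S_D : fcomm S D. Proof. exact: fcomm_nop. Qed.
Let D_S : fcomm D S. Proof. exact: fcommC. Qed.

Let A_S2 n m t : A n (S2 m t) = S2 m (A n t) + 2 *: S (n + m) t.
Proof.
rewrite (nop_commutator (D := A n) (AS n) (AS n)) nop_onel nop_oner.
by rewrite scaler_nat mulr2n.
Qed.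

Let A_J n m t : A n (J m t) = J m (A n t) + A (n + m) t.
Proof.
rewrite (nop_commutator (D := A n) (X' := fzero T) (n := n) _ (AS n)).
  by rewrite nop_zerol nop_oner add0r.
by move=> p u; rewrite [LHS]AA addr0.
Qed.

Let A_K n m t : A n (K m t) = K m (A n t) + 2 *: J (n + m) t.
Proof.
rewrite (nop_commutator (D := A n) (X' := fzero T) (Y' := flin 2 S (fzero T))
  (n := n)).
- by rewrite nop_zerol nop_linr nop_zeror add0r addr0.
- by move=> p u; rewrite [LHS]AA addr0.
- by move=> p u; rewrite [LHS]A_S2 /= addr0.
Qed.

Let S_J n m t : S n (J m t) = J m (S n t) - S (n + m) t.
Proof.
rewrite (nop_commutator (D := S n) (X' := flin (-1) (fone T) (fzero T))
  (Y' := fzero T) (n := n)).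
- by rewrite nop_zeror nop_linl nop_zerol nop_onel !addr0 scaleN1r.
- by move=> p u; rewrite [LHS]SA /= addr0 scaleN1r.
- by move=> p u; rewrite [LHS]SS addr0.
Qed.

Let S_K n m t : S n (K m t) = K m (S n t) - S2 (n + m) t.
Proof.
rewrite (nop_commutator (D := S n) (X' := flin (-1) (fone T) (fzero T))
  (Y' := fzero T) (n := n)).
- by rewrite nop_zeror nop_linl nop_zerol nop_onel !addr0 scaleN1r.
- by move=> p u; rewrite [LHS]SA /= addr0 scaleN1r.
- by move=> p u; rewrite [LHS]S_S2 addr0.
Qed.

Let J_S n m t : J n (S m t) = S m (J n t) + S (n + m) t.
Proof. by rewrite S_J [m + n]addrC subrK. Qed.

Let K_S n m t : K n (S m t) = S m (K n t) + S2 (n + m) t.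
Proof. by rewrite S_K [m + n]addrC subrK. Qed.

Let J_A n m t : J n (A m t) = A m (J n t) - A (n + m) t.
Proof. by rewrite A_J [m + n]addrC addrK. Qed.

Let K_A n m t : K n (A m t) = A m (K n t) - 2 *: J (n + m) t.
Proof. by rewrite A_K [m + n]addrC addrK. Qed.

Let J_S2 n m t : J n (S2 m t) = S2 m (J n t) + 2 *: S2 (n + m) t.
Proof.
rewrite (nop_commutator (D := J n) (J_S n) (J_S n)) (nop_comm SS).
by rewrite scaler_nat mulr2n.
Qed.

(** Twice the cube of a*, left unexpanded because only its dependence on a single index matters
    below. *)
Let S3 : qfield T := flin 1 (fnop S2 S) (fnop S S2).

Let K_S2 n m t : K n (S2 m t) = S2 m (K n t) + S3 (n + m) t.
Proof.
rewrite (nop_commutator (D := K n) (K_S n) (K_S n)) (nop_comm S2_S).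
by rewrite /= scale1r.
Qed.

(** The two products are :a a*: with opposite signs and cancel, except for the price of moving the
    first cut from n to 0, where the contraction is 1. *)
Let J_J n m t : J n (J m t) = J m (J n t) - n%:~R *: fone T (n + m) t.
Proof.
rewrite (nop_commutator (D := J n) (X' := flin (-1) A (fzero T)) (n := n) _ (J_S n)).
  rewrite nop_linl nop_zerol addr0 (nop_cut (fone T) AS) -scaler_int.
  wak_lmod.
by move=> p u; rewrite [LHS]J_A /= addr0 scaleN1r.
Qed.

(** The contraction of a with a*^2 is 2 a*, whence -2n a* when the cut of -:a a*^2: moves back to 0;
    the products themselves leave -K + 2 K. *)
Let J_K n m t : J n (K m t) = K m (J n t) + K (n + m) t
   - (2 * n%:~R) *: S (n + m) t.
Proof.
rewrite (nop_commutator (D := J n) (X' := flin (-1) A (fzero T))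
  (Y' := flin 2 S2 (fzero T)) (n := n)).
- rewrite nop_linl nop_linr nop_zerol nop_zeror !addr0.
  rewrite (nop_cut (fun k t => 2 *: S k t) A_S2) -scaler_int.
  wak_lmod.
- by move=> p u; rewrite [LHS]J_A /= addr0 scaleN1r.
- by move=> p u; rewrite [LHS]J_S2 /= addr0.
Qed.

(** Its two terms would cancel if a and a* commuted. The remainder is the double contraction in K
    with K, which stays unevaluated. *)
Let KK : qfield T := flin (-2) (fnop J S2) (fnop A S3).

Let K_K n m t : K n (K m t) = K m (K n t) + KK (n + m) t
   - (4 * n%:~R) *: S2 (n + m) t.
Proof.
rewrite (nop_commutator (D := K n) (X' := flin (-2) J (fzero T)) (n := n) _ (K_S2 n)).
  rewrite nop_linl nop_zerol addr0.
  rewrite (nop_cut (fun k t => 2 *: S2 k t) J_S2) -scaler_int.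
  rewrite /KK; wak_lmod.
by move=> p u; rewrite [LHS]K_A /= addr0 scaleNr.
Qed.

Let J_D n m t : J n (D m t) = D m (J n t) + D (n + m) t.
Proof.
rewrite (nop_commutator (D := J n) (Y' := fzero T) (J_S n)).
  by rewrite nop_zeror addr0 (nop_comm Sb).
by move=> p u; rewrite [LHS]J_b addr0.
Qed.

Let K_D n m t : K n (D m t) = D m (K n t) + fnop S2 b (n + m) t.
Proof.
rewrite (nop_commutator (D := K n) (Y' := fzero T) (K_S n)).
  by rewrite nop_zeror addr0 (nop_comm S2_b).
by move=> p u; rewrite [LHS]K_b addr0.
Qed.

Let D_K n m t : D n (K m t) = K m (D n t) - fnop S2 b (n + m) t.
Proof. by rewrite K_D [m + n]addrC addrK. Qed.

Let b_D n m t : b n (D m t) =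
  D m (b n t) + (2 * (kappa + 2) * n%:~R) *: S (n + m) t.
Proof.
rewrite (nop_commutator (D := b n) (X' := fzero T) (n := n)
  (Y' := flin (2 * (kappa + 2) * n%:~R) (fone T) (fzero T))).
- by rewrite nop_zerol nop_linr nop_zeror nop_oner add0r addr0.
- by move=> p u; rewrite [LHS]b_S addr0.
- by move=> p u; rewrite [LHS]bb /= addr0.
Qed.

Let D_b n m t : D n (b m t) =
  b m (D n t) - (2 * (kappa + 2) * m%:~R) *: S (n + m) t.
Proof. by rewrite b_D [m + n]addrC addrK. Qed.

Let DD : qfield T := flin (- (2 * (kappa + 2))) (fnop S (feuler S)) (fzero T).

Let D_D n m t : D n (D m t) = D m (D n t) + DD (n + m) t
  + (2 * (kappa + 2) * n%:~R) *: S2 (n + m) t.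
Proof.
(* The commutator of D(n) with b(p) carries the factor p, while Y' has to be a field in the index n
   + p. Writing p = (n + p) - n splits it into a multiple of [feuler S] and a multiple of [S]. *)
rewrite (nop_commutator (D := D n) (X' := fzero T) (n := n)
  (Y' := flin (2 * (kappa + 2) * n%:~R) S
           (flin (- (2 * (kappa + 2))) (feuler S) (fzero T)))).
- rewrite nop_zerol !nop_linr nop_zeror.
  rewrite /DD; wak_lmod.
- by move=> p u; rewrite [LHS]D_S addr0.
- by move=> p u; rewrite [LHS]D_b /=; wak_lmod.
Qed.

Let A_D n m t : A n (D m t) = D m (A n t) + b (n + m) t.
Proof.
rewrite (nop_commutator (D := A n) (Y' := fzero T) (AS n)).
  by rewrite nop_zeror addr0 nop_onel.
by move=> p u; rewrite [LHS]Ab addr0.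
Qed.

Let hE n t : fwak_h n t = (-2) *: J n t + b n t. Proof. by []. Qed.

Let fE n t :
  fwak_f n t = (-1) *: K n t + (- kappa *: (n%:~R *: S n t) + D n t).
Proof. by []. Qed.

Lemma fwak_he n m t :
  fwak_h n (A m t) - A m (fwak_h n t) = 2 *: A (n + m) t.
Proof. by rewrite !hE !(fieldD, fieldZ) J_A b_A; wak_lmod. Qed.

Lemma fwak_ef n m t : A n (fwak_f m t) - fwak_f m (A n t) =
  fwak_h (n + m) t + (kappa * n%:~R) *: fone T (n + m) t.
Proof.
(* The derivative term of f contributes -kappa m delta_{n+m,0}, and m = -n on the support of
   delta. *)
have mn : m%:~R *: fone T (n + m) t = - (n%:~R *: fone T (n + m) t).
  apply/eqP; rewrite -addr_eq0 -scalerDl -intrD [m + n]addrC /=.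
  by case: (n + m =P 0) => [->|_]; rewrite ?scale0r ?scaler0.
rewrite !fE hE !(fieldD, fieldZ) A_K AS A_D !scalerDr mn; wak_lmod.
Qed.

(** Four times the anomaly -n of J is offset by the Heisenberg term 2(kappa + 2)n, which leaves 2
    kappa n: here the shift of the level by 2 originates. *)
Lemma fwak_hh n m t : fwak_h n (fwak_h m t) - fwak_h m (fwak_h n t) =
  (2 * kappa * n%:~R) *: fone T (n + m) t.
Proof.
rewrite !hE !(fieldD, fieldZ) J_J bb b_J J_b.
wak_lmod.
Qed.

(** The coefficients of a*(n + m) are -4n from J with K, 2(kappa + 2)n from b with D and 2 kappa m
    from J with the derivative. Their sum 2 kappa (n + m) is the derivative term of -2 f. *)
Lemma fwak_hf n m t : fwak_h n (fwak_f m t) - fwak_f m (fwak_h n t) =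
  (-2) *: fwak_f (n + m) t.
Proof.
rewrite !fE !hE !(fieldD, fieldZ) J_K J_S J_D b_K b_S b_D.
wak_lmod.
Qed.

Lemma fwak_ff (two_inj : forall u : T, u + u = 0 -> u = 0) n m t :
  fwak_f n (fwak_f m t) - fwak_f m (fwak_f n t) = 0.
Proof.
(* The last coefficient collects -4n from K with K, 2(kappa + 2)n from D with D, and kappa (m - n)
   from K with the derivative of a*. The two mixed terms of K and D cancel. *)
pose G k t := KK k t + DD k t + (kappa * k%:~R) *: S2 k t.
have ffE k l u : fwak_f k (fwak_f l u) - fwak_f l (fwak_f k u) = G (k + l) u.
  rewrite !fE !(fieldD, fieldZ) (K_K k l) (K_S k l) (K_D k l) (S_K k l) (SS k l)
    (S_D k l) (D_K k l) (D_S k l) (D_D k l) /G.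
  wak_lmod.
rewrite ffE; apply: two_inj.
by rewrite -{1}(ffE n m t) [n + m]addrC -(ffE m n t) addrA subrK subrr.
Qed.

End WakimotoFields.

(** * Eigenvalues of the modes of e, h and f on w *)

Section WhittakerEigenvalues.
Variables (F : comNzRingType) (T : lmodType F) (kappa : F) (A S b : qfield T).
Variables (lam mu eta : nat -> F) (N M P : nat) (w : T).
Hypotheses (SS : fcomm S S) (Sb : fcomm S b)
  (Aw : forall i : nat, A i w = lam i *: w)
  (Sw : forall i : nat, (0 < i)%N -> S i w = mu i *: w)
  (bw : forall i : nat, b i w = eta i *: w)
  (lam0 : forall i, (N < i)%N -> lam i = 0)
  (mu0 : forall i, (M < i)%N -> mu i = 0)
  (eta0 : forall i, (P < i)%N -> eta i = 0).

(** Nothing is assumed about [S 0 w]. The value 0 at i = 0 lets the sums start at 0, provided that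
    the other factor kills w in those terms. *)
Let nu (i : nat) : F := if i == 0%N then 0 else mu i.

Let nu0 i : (M < i)%N -> nu i = 0.
Proof. by rewrite /nu => /mu0 ->; case: eqP. Qed.

Let Snu i : (0 < i)%N -> S i w = nu i *: w.
Proof. by case: i => // i _; rewrite Sw. Qed.

Let Sw0 (k : int) : (M%:Z < k)%O -> S k w = 0.
Proof.
case: k => // k Mk; rewrite Sw; last by lia.
by rewrite mu0 ?scale0r//; lia.
Qed.

Let Aw0 (k : int) : (N%:Z < k)%O -> A k w = 0.
Proof. by case: k => // k Nk; rewrite Aw lam0 ?scale0r//; lia. Qed.

Let bw0 (k : int) : (P%:Z < k)%O -> b k w = 0.
Proof. by case: k => // k Nk; rewrite bw eta0 ?scale0r//; lia. Qed.

Lemma fnop_eigen (X Y : qfield T) (c : nat -> F) (n : nat) :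
    (forall k : int, (k < 0)%O || (n%:Z < k)%O -> nop_term 0 X Y n k w = 0) ->
    (forall k : nat, (k <= n)%N -> Y (n - k)%N (X k w) = c k *: w) ->
  fnop X Y n w = (\sum_(k < n.+1) c k) *: w.
Proof.
move=> out inn; rewrite /= /nop (@finsum_nat _ _ _ n.+1) ?scaler_suml; last first.
  by move=> k kn; apply: out; move: kn; rewrite negb_and -ltNge -leNgt; lia.
apply: eq_bigr => k _; rewrite /nop_term; have -> : (k%:Z < 0)%O = false by [].
have kn : (k <= n)%N by rewrite -ltnS.
by rewrite subzn// inn.
Qed.

(** M <= n makes a*(n - k) kill w for k < 0. N < n removes k > n, and keeps n - k positive for the k
    <= N that survive. These are the two bounds in q. *)
Lemma eigen_J (n : nat) : (M <= n)%N -> (N < n)%N ->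
  fnop A S n w = (\sum_(1 <= l < M.+1) mu l * lam (n - l)%N) *: w.
Proof.
move=> Mn Nn.
rewrite (@fnop_eigen _ _ (fun k => lam k * nu (n - k)%N)) => [||k kn].
(* After the substitution l = n - k, the term l = 0 carries [nu 0], and those with l > M vanish. *)
- congr (_ *: w); rewrite (reindex_inj rev_ord_inj)/=.
  rewrite (eq_bigr (fun l : 'I_n.+1 => (fun l => nu l * lam (n - l)%N) l)) /=.
    rewrite -(big_mkord xpredT (fun l => nu l * lam (n - l)%N)).
    rewrite big_ltn// /nu/= mul0r add0r (big_cat_nat (n := M.+1))//=.
    rewrite [X in _ + X]big_nat_cond [X in _ + X]big1 ?addr0.
      by rewrite !big_nat; apply: eq_bigr => -[|l].
    by move=> [|l]// /andP[/andP[Ml _] _]; rewrite mu0// mul0r.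
  move=> l _; rewrite subSS subKn 1?mulrC//; by rewrite -ltnS.
- move=> k kn; rewrite /nop_term; case: ifP => k0.
    by rewrite Sw0 ?linear0//; lia.
  by rewrite Aw0 ?linear0//; lia.
rewrite Aw fieldZ; have [kN|Nk] := leqP k N.
  by rewrite Snu ?scalerA//; lia.
by rewrite lam0// mul0r !scale0r.
Qed.

(** In the terms that contain a*(0) the other factor is a*(n), which kills w as n > M. *)
Lemma eigen_S2 (n : nat) : (M < n)%N ->
  fnop S S n w = (\sum_(j < n.+1) nu j * nu (n - j)%N) *: w.
Proof.
move=> Mn; apply: (@fnop_eigen _ _ (fun j => nu j * nu (n - j)%N)) => [k kn|j jn].
  rewrite /nop_term; case: ifP => k0.
    by rewrite (Sw0 (k := n%:Z - k)) ?linear0//; lia.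
  by rewrite (Sw0 (k := k)) ?linear0//; lia.
have [->|j0] := posnP j.
  by rewrite SS subn0 (Sw0 (k := n)) ?linear0 /nu ?mul0r ?scale0r//; lia.
rewrite Snu// fieldZ; have [nj|nj] := posnP (n - j).
  have -> : nu j = 0 by apply: nu0; lia.
  by rewrite mul0r !scale0r.
by rewrite Snu// scalerA.
Qed.

(** For 0 <= l <= N the inner square has index n - l > M, so [eigen_S2] applies. For l < 0 its index
    exceeds 2M, and two indices with that sum cannot both be at most M. *)
Lemma eigen_K (n : nat) : (M + N < n)%N -> (2 * M <= n)%N ->
  fnop A (fnop S S) n w =
  (\sum_(l < n.+1) lam l * (\sum_(j < (n - l).+1) nu j * nu (n - l - j)%N)) *: w.
Proof.
move=> MNn MMn; apply: (@fnop_eigen _ _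
  (fun l => lam l * (\sum_(j < (n - l).+1) nu j * nu (n - l - j)%N))) => [k kn|l ln].
  rewrite /nop_term; case: ifP => k0; last by rewrite Aw0 ?linear0//; lia.
  have [m -> Mm] : exists2 m : nat, n%:Z - k = m & (2 * M < m)%N.
    by exists `|n%:Z - k|%N; lia.
  rewrite eigen_S2; last by lia.
  rewrite big1 ?scale0r ?linear0// => -[j jm] _ /=.
  have [jM|Mj] := leqP j M; last by rewrite nu0 ?mul0r.
  by rewrite (nu0 (i := (m - j)%N)) ?mulr0//; lia.
rewrite Aw fieldZ; have [kN|Nk] := leqP l N.
  by rewrite eigen_S2 ?scalerA//; lia.
by rewrite lam0// mul0r !scale0r.
Qed.

(** P < n makes b(n - k) kill w for every k <= 0, in particular next to a*(0); M < n disposes of k >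
    n. *)
Lemma eigen_D (n : nat) : (M < n)%N -> (P < n)%N ->
  fnop S b n w = (\sum_(j < n.+1) nu j * eta (n - j)%N) *: w.
Proof.
move=> Mn Pn; apply: (@fnop_eigen _ _ (fun j => nu j * eta (n - j)%N)) => [k kn|j jn].
  rewrite /nop_term; case: ifP => k0; first by rewrite bw0 ?linear0//; lia.
  by rewrite (Sw0 (k := k)) ?linear0//; lia.
have [->|j0] := posnP j.
  by rewrite -Sb subn0 bw0 ?linear0 /nu ?mul0r ?scale0r//; lia.
by rewrite Snu// fieldZ bw scalerA.
Qed.

(** Eliminates the last index of a sum constrained by a total degree. *)
Lemma sum_ord_antidiagonal (f : nat -> F) (k n : nat) : (k <= n)%N ->
  \sum_(i < n.+1) (if (k + i == n)%N then f i else 0) = f (n - k)%N.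
Proof.
move=> kn; have nk : (n - k < n.+1)%N by rewrite ltnS leq_subr.
rewrite (bigD1 (Ordinal nk))//= subnKC// eqxx big1 ?addr0// => i /eqP ink.
case: eqP => // kin; case: ink; apply: val_inj => /=; lia.
Qed.

Lemma eigen_h (n : nat) : (M <= n)%N -> (N < n)%N ->
  fwak_h A S b n w =
  (- (2 * \sum_(1 <= l < M.+1) mu l * lam (n - l)%N) + eta n) *: w.
Proof.
move=> Mn Nn; transitivity ((-2) *: fnop A S n w + b n w); first by [].
rewrite (eigen_J Mn Nn) bw scalerA.
by rewrite -scalerDl mulNr.
Qed.

Lemma eigen_f (n : nat) : (M + N < n)%N -> (2 * M <= n)%N -> (P < n)%N ->
  fwak_f kappa A S b n w =
  (- (\sum_(k1 < n.+1) \sum_(k2 < n.+1)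
         \sum_(k3 < n.+1 | [&& (1 <= k1)%N, (1 <= k2)%N & (k1 + k2 + k3 == n)%N])
           mu k1 * mu k2 * lam k3)
    + \sum_(j1 < n.+1)
        \sum_(j2 < n.+1 | (1 <= j1)%N && (j1 + j2 == n)%N) mu j1 * eta j2
    - kappa * n%:R * mu n) *: w.
Proof.
move=> MNn MMn Pn; transitivity ((-1) *: fnop A (fnop S S) n w +
  (- kappa *: (n%:R *: S n w) + fnop S b n w)); first by [].
rewrite (eigen_K MNn MMn).
rewrite eigen_D ?Sw ?scalerA -?scalerDl//; try lia.
congr (_ *: w); rewrite mulN1r mulNr -mulrA -addrA; congr (- _ + _).
  (* Bringing k3 outermost matches it with the index l of a; k1 then corresponds to j, and k2 is
     forced to be n - l - j. *)
  under [RHS]eq_bigr do under eq_bigr do rewrite big_mkcond/=.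
  under [RHS]eq_bigr do rewrite exchange_big/=.
  rewrite [RHS]exchange_big /=; apply: eq_bigr => -[l ln] _ /=.
  have nln : ((n - l).+1 <= n.+1)%N by rewrite ltnS leq_subr.
  rewrite (big_ord_widen _ (fun j => nu j * nu (n - l - j)%N) nln) mulr_sumr.
  rewrite big_mkcond; apply: eq_bigr => -[j jn] _ /=; rewrite ltnS.
  have [jnl|nlj] := leqP j (n - l); last first.
    by rewrite big1// => -[k kn] _ /=; case: ifP => // /and3P[_ _ /eqP]; lia.
  rewrite -subnDA; have ljn : (l + j <= n)%N by lia.
  rewrite -(@sum_ord_antidiagonal (fun i => nu i) (l + j)%N n) // !mulr_sumr.
  apply: eq_bigr => -[k kn] _ /=; rewrite /nu.
  have -> : (l + j + k == n)%N = (j + k + l == n)%N.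
    by rewrite addnC addnA [(k + l)%N]addnC; lia.
  by case: j {jn jnl ljn} => [|j]; case: k {kn} => [|k];
    rewrite ?andbF ?mul0r ?mulr0 ?if_same ?mulr0//=; case: ifP;
    rewrite ?mulr0// mulrC.
rewrite addrC mulrA mulNr; congr (_ + _); apply: eq_bigr => -[j jn] _ /=.
rewrite -(@sum_ord_antidiagonal (fun i => nu j * eta i)) // [RHS]big_mkcond.
apply: eq_bigr => i _; rewrite /nu; case: j {jn} => //=.
by rewrite !mul0r if_same.
Qed.

End WhittakerEigenvalues.

(** * Linear maps out of free modules and tensor products *)

Section FreeModuleInduction.
Variables (F : comNzRingType) (K : choiceType).

Lemma malg_ind (P : set {malg F[K]}) : subspace P ->
  (forall k, P << k >>) -> forall u, P u.
Proof.
move=> [P0 PD] Pk u; rewrite [u]monalgE.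
elim/big_rec: _ => // k y _ Py.
have -> : << u@_k *g k >> = u@_k *: << k >> :> {malg F[K]}.
  by apply/malgP => i; rewrite mcoeffZ !mcoeffU mulr_natr.
exact: PD.
Qed.

Definition malg_ext (phi : K -> F) (u : {malg F[K]}) : F^o :=
  \sum_(k <- msupp u) u@_k * phi k.

Let malg_extEw (e : {fset K}) phi (u : {malg F[K]}) :
  (msupp u `<=` e)%fset -> malg_ext phi u = \sum_(k <- e) u@_k * phi k.
Proof.
move=> le; rewrite /malg_ext (big_fset_incl _ le) //= => k _ /mcoeff_outdom ->.
by rewrite mul0r.
Qed.

Lemma malg_ext_linear phi : linear (malg_ext phi).
Proof.
move=> a u v; set e := (msupp (a *: u + v) `|` msupp u `|` msupp v)%fset.
rewrite 3?(@malg_extEw e); first last.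
- by rewrite /e -fsetUA fsubsetUl.
- by rewrite /e -fsetUA fsubsetU // fsubsetUl orbT.
- by rewrite /e fsubsetUr.
rewrite scaler_sumr -big_split; apply: eq_bigr => k _ /=.
by rewrite mcoeffD mcoeffZ mulrDl -mulrA.
Qed.

Lemma malg_ext_basis phi k : malg_ext phi << k >> = phi k.
Proof.
by rewrite (malg_extEw _ msuppU_le) big_seq_fset1 mcoeffUU mul1r.
Qed.

End FreeModuleInduction.

Lemma linear_fun0 (F : comNzRingType) (U V : lmodType F) (f : U -> V) :
  linear f -> f 0 = 0.
Proof. by move=> lf; have := lf (-1) 0 0; rewrite scaler0 addr0 scaleN1r addNr. Qed.

Lemma subspace_eq_linear (F : comNzRingType) (U V : lmodType F) (f g : U -> V) :
  linear f -> linear g -> subspace [set u | f u = g u].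
Proof.
move=> lf lg; split=> [|a u v /= fgu fgv]; last by rewrite lf lg fgu fgv.
by rewrite /= !linear_fun0.
Qed.

Lemma subspace_preim (F : comNzRingType) (U V : lmodType F) (f : U -> V)
    (P : set V) :
  linear f -> subspace P -> subspace [set u | P (f u)].
Proof.
move=> lf [P0 PD]; split=> [|a u v /= Pu Pv]; rewrite /= ?linear_fun0//.
by rewrite lf; apply: PD.
Qed.

Section TensorLemmas.
Variables (F : comNzRingType) (V W : lmodType F).
Implicit Types (f : V -> V) (g : W -> W) (t : tensor V W).

Lemma tens_ind (P : set (tensor V W)) : subspace P ->
  (forall v w, P (tens v w)) -> forall t, P t.
Proof.
move=> mP Pt t; rewrite -[t]qreprK; move: (qrepr _ t) => u.
apply: (malg_ind (P := [set u | P (qproj _ u)])); last by case=> v w; apply: Pt.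
by apply: subspace_preim mP => a x y; rewrite linearP.
Qed.

(** Serves to detect non-zero pure tensors. It is computed on a chosen representative, and is
    independent of that choice once both forms are linear. *)
Definition tens_form (phi : V -> F) (chi : W -> F) (t : tensor V W) : F^o :=
  malg_ext (fun k : V * W => phi k.1 * chi k.2) (qrepr _ t).

Section TensorForm.
Variables (phi : V -> F^o) (chi : W -> F^o).
Hypotheses (phiL : linear phi) (chiL : linear chi).

Let tens_form_qproj u : tens_form phi chi (qproj _ u) =
  malg_ext (fun k : V * W => phi k.1 * chi k.2) u.
Proof.
set f := malg_ext _; have fL : linear f by exact: malg_ext_linear.
have fB x y : f (x - y) = f x - f y.
  by rewrite addrC -scaleN1r fL scaleN1r addrC.
apply/eqP; rewrite -subr_eq0 /tens_form -/f -fB; apply/eqP.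
apply: (spanp_min (S := [set x | f x = 0])) (qreprP _ u).
  by apply: subspace_eq_linear => // a x y; rewrite scaler0 addr0.
move=> x [[a [m [m' [n ->]]]]|[a [m [n [n' ->]]]]] /=;
  rewrite fB fL /f !malg_ext_basis/=.
  apply/eqP; rewrite subr_eq0 phiL mulrDl; apply/eqP; congr (_ + _).
  exact/esym/mulrA.
apply/eqP; rewrite subr_eq0 chiL mulrDr; apply/eqP; congr (_ + _).
exact: mulrCA.
Qed.

Lemma tens_form_linear : linear (tens_form phi chi).
Proof.
move=> a x y; rewrite -[x]qreprK -[y]qreprK -linearP !tens_form_qproj.
exact: malg_ext_linear.
Qed.

Lemma tens_formE v w : tens_form phi chi (tens v w) = phi v * chi w.
Proof. by rewrite /tens tens_form_qproj malg_ext_basis. Qed.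

End TensorForm.

End TensorLemmas.

(** * Modules induced from characters of commutator algebras *)

Section WhittakerQuotients.
Variables (F : comNzRingType) (X : choiceType) (c : X -> X -> F).
Variables (D : set X) (chi : X -> F).
Local Notation whit := (whit c D chi).
Local Notation vac := (whit_vec c D chi).
Implicit Types (m : whit) (x y : X).

Lemma wact_linear u : linear (@wact _ _ c D chi u).
Proof. exact: lact_linear. Qed.

Lemma wactM u v m : wact (u * v) m = wact u (wact v m).
Proof. by rewrite -[m]qreprK /wact !lactE mulrA. Qed.

Lemma wactDl a u v m : wact (a *: u + v) m = a *: wact u m + wact v m.
Proof.
rewrite -[m]qreprK /wact !lactE mulrDl -quotalg_scaleAl.
exact: (linearP (qproj _)).
Qed.

Lemma wact1 m : wact 1 m = m.
Proof. by rewrite -[m]qreprK /wact !lactE mul1r. Qed.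

Lemma gen_comm x y : gen c x * gen c y = gen c y * gen c x + c x y *: (1 : ccr c).
Proof.
apply/eqP; rewrite addrC -subr_eq -subr_eq0 /gen -!aprojM -aproj1 -aprojZ.
rewrite /aproj; set u := _ * _; set v := _ * _.
rewrite -!linearB /= -[0](linear0 (qproj _)) qproj_eq subr0.
by apply: spanp_sub; exists 1, (u - v - (c x y)%:A), 1; rewrite mul1r mulr1;
  split=> //; exists x, y.
Qed.

Lemma wact_gen_comm x y m : wact (gen c x) (wact (gen c y) m) =
  wact (gen c y) (wact (gen c x) m) + c x y *: m.
Proof. by rewrite -!wactM gen_comm addrC wactDl wact1 addrC. Qed.

Lemma wact_vac x : D x -> wact (gen c x) vac = chi x *: vac.
Proof.
move=> Dx; rewrite /wact /vac lactE mulr1 -linearZ /=; apply/eqP.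
rewrite qproj_eq; apply: spanp_sub.
by exists 1, (gen c x - chi x *: (1 : ccr c)); rewrite mul1r; split=> //; exists x.
Qed.

(** Words in the generators span the free algebra, hence their images on the vacuum span the module;
    the induction strips the first letter of a word. *)
Lemma whit_ind (P : set whit) : subspace P -> P vac ->
  (forall x m, P m -> P (wact (gen c x) m)) -> forall m, P m.
Proof.
move=> mP Pv Px m; rewrite -[m]qreprK; set u := qrepr _ _.
rewrite -(aprojK u); move: (qrepr _ u) => {u m} u.
pose f (u : freealg F X) : whit := qproj _ (aproj _ u).
have lf : linear f by move=> a y z; rewrite /f /aproj !linearP.
suff Pf k : P (f << k >>) by apply: (malg_ind (subspace_preim lf mP) Pf u).
have [s ks] : exists s : seq X, k = s :> seq X by exists k.
elim: s k ks => [|x s IH] k ks.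
  by have -> : k = mone by [apply/eqP; rewrite fmP ks fm1]; apply: Pv.
have kE : k = mmul (fmu x) (FMonom s) by apply/eqP; rewrite fmP ks fmM fmuE.
have -> : f << k >> = wact (gen c x) (f << FMonom s >>).
  rewrite /f /wact lactE -aprojM; congr (qproj _ (aproj _ _)).
  by rewrite kE /var malgM_def fgmulUU mulr1.
exact/Px/IH.
Qed.

(** For n large [x n] commutes with any given generator, so a bound valid on the vacuum propagates
    along words. *)
Lemma whit_smooth (x : int -> X) :
    (exists n0 : int, forall n, (n0 <= n)%O -> D (x n) /\ chi (x n) = 0) ->
    (forall y, exists n0 : int, forall n, (n0 <= n)%O -> c (x n) y = 0) ->
  forall m, exists n0 : int, forall n, (n0 <= n)%O -> wact (gen c (x n)) m = 0.
Proof.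
move=> [n0 Dx] cx; apply: whit_ind => [||y m [n1 m0]].
- split=> [|a u v [n1 u0] [n2 v0]].
    by exists 0 => n _; apply/linear_fun0/wact_linear.
  exists (Num.max n1 n2) => n nn.
  by rewrite wact_linear u0 ?v0 ?scaler0 ?addr0//; lia.
- by exists n0 => n /Dx[Dn chi0]; rewrite wact_vac// chi0 scale0r.
have [n2 cy] := cx y; exists (Num.max n1 n2) => n nn.
rewrite wact_gen_comm m0 ?cy ?scale0r ?addr0; try lia.
exact/linear_fun0/wact_linear.
Qed.

End WhittakerQuotients.

(** Vanishing outside a finite box makes the double sum and both iterated sums finite at once. *)
Lemma finsum_pair (F : comNzRingType) (T : lmodType F) (I J : choiceType)
    (g : I * J -> T) (A : {fset I}) (B : {fset J}) :
  (forall i j, (i \notin A) || (j \notin B) -> g (i, j) = 0) ->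
  finsum g = finsum (fun i => finsum (fun j => g (i, j))).
Proof.
move=> g0; rewrite [RHS](finsumE (A := A)) => [|i iA]; last first.
  by rewrite /finsum fsbig1// => j _; rewrite g0 ?iA.
rewrite /finsum (fsbigE [seq (i, j) | i <- A, j <- B])//; first last.
- case=> i j _ ij; apply: g0; apply: contraR ij.
  rewrite negb_or !negbK => /andP[iA jB].
  by apply/allpairsP; exists (i, j).
- by apply: allpairs_uniq => // -[? ?] [? ?] _ _ [-> ->].
under eq_bigl do rewrite in_setT.
rewrite big_allpairs_dep; apply: eq_bigr => i _.
rewrite -[LHS](finsumE (g := fun j => g (i, j)))// => j jB.
by rewrite g0 ?jB ?orbT.
Qed.

(** Reduces smoothness to a spanning set, such as the pure tensors. *)
Lemma smooth_subspace (F : comNzRingType) (U : lmodType F) (X : int -> U -> U) :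
  (forall n, linear (X n)) ->
  subspace [set t | exists n0 : int, forall n, (n0 <= n)%O -> X n t = 0].
Proof.
move=> lX; split=> [|a u v [n1 u0] [n2 v0]].
  by exists 0 => n _; apply: linear_fun0.
exists (Num.max n1 n2) => n nn.
by rewrite lX u0 ?v0 ?scaler0 ?addr0//; lia.
Qed.

(** * From the Wakimoto sums to normally ordered fields *)

Section WeylHeisenbergModule.
Variables (F : comNzRingType) (kappa : F) (T : lmodType F).
Variables (wact : weyl F -> T -> T) (hact : int -> T -> T).
Local Notation g := (gen (@weyl_comm F)).
Hypotheses (wact_linear : forall u, linear (wact u))
  (wactM : forall u v t, wact (u * v) t = wact u (wact v t))
  (wact_comm : forall x y t,
     wact (g x) (wact (g y) t) = wact (g y) (wact (g x) t) + weyl_comm F x y *: t)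
  (hact_linear : forall n, linear (hact n))
  (hact_comm : forall n k t,
     hact n (hact k t) = hact k (hact n t) + heis_comm kappa n k *: t)
  (wact_hact : forall u n t, wact u (hact n t) = hact n (wact u t)).
Hypotheses
  (a_smooth : forall t, exists n0 : int, forall n, (n0 <= n)%O ->
     wact (g (Wa n)) t = 0)
  (as_smooth : forall t, exists n0 : int, forall n, (n0 <= n)%O ->
     wact (g (Was n)) t = 0)
  (b_smooth : forall t, exists n0 : int, forall n, (n0 <= n)%O -> hact n t = 0).

Definition weyl_a_field : qfield T :=
  QField (fun n => wact_linear (g (Wa n))) a_smooth.
Definition weyl_as_field : qfield T :=
  QField (fun n => wact_linear (g (Was n))) as_smooth.
Definition heis_field : qfield T := QField hact_linear b_smooth.

Local Notation A := weyl_a_field.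
Local Notation S := weyl_as_field.
Local Notation b := heis_field.

Lemma weyl_aa : fcomm A A.
Proof. by move=> n m t; rewrite /= wact_comm scale0r addr0. Qed.
Lemma weyl_asas : fcomm S S.
Proof. by move=> n m t; rewrite /= wact_comm scale0r addr0. Qed.
Lemma weyl_a_heis : fcomm A b.
Proof. by move=> n m t; rewrite /= wact_hact. Qed.
Lemma weyl_as_heis : fcomm S b.
Proof. by move=> n m t; rewrite /= wact_hact. Qed.
Lemma weyl_aas n m t : A n (S m t) = S m (A n t) + fone T (n + m) t.
Proof. by rewrite /= wact_comm. Qed.
Lemma heis_heis n m t : b n (b m t) =
  b m (b n t) + (2 * (kappa + 2) * n%:~R) *: fone T (n + m) t.
Proof. by rewrite /= hact_comm scalerA. Qed.

Let A_S_creators n m t : (n < 0)%O -> (m <= 0)%O -> A n (S m t) = S m (A n t).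
Proof.
move=> n0 m0; rewrite weyl_aas /=; have -> : (n + m == 0) = false by lia.
by rewrite scale0r addr0.
Qed.

Let wact_seq1 x t : wact (\prod_(z <- [:: x]) g z) t = wact (g x) t.
Proof. by rewrite big_seq1. Qed.

Let wact_cons x y s t : wact (\prod_(z <- [:: x, y & s]) g z) t =
  wact (g x) (wact (\prod_(z <- y :: s) g z) t).
Proof. by rewrite big_cons wactM. Qed.

(** [nop_term] looks at the index of a only, [normal_order] at both factors. They disagree only when
    both are creators; the indices then have a negative sum and the factors commute. *)
Lemma normal_order2E n (l : int) t :
  wact (normal_order F [:: Was (n - l); Wa l]) t = nop_term 0 A S n l t.
Proof.
rewrite /normal_order /nop_term /=.
case: (ltP l 0) => [l0|l0]; case: (leP 1 (n - l)) => [nl|nl] /=;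
  rewrite wact_cons wact_seq1 //.
by symmetry; apply: A_S_creators; lia.
Qed.

Lemma normal_order3E (j k l : int) t :
  wact (normal_order F [:: Was j; Was k; Wa l]) t =
  if (l < 0)%O then A l (S j (S k t)) else S j (S k (A l t)).
Proof.
have SA (i : int) u : (l < 0)%O -> (i < 1)%O ->
    wact (g (Was i)) (wact (g (Wa l)) u) = wact (g (Wa l)) (wact (g (Was i)) u).
  by move=> l0 i1; symmetry; apply: A_S_creators; lia.
have SS i1 i2 u : wact (g (Was i1)) (wact (g (Was i2)) u) =
    wact (g (Was i2)) (wact (g (Was i1)) u).
  exact: weyl_asas.
rewrite /normal_order /=.
case: (ltP l 0) => l0; case: (leP 1 j) => j1; case: (leP 1 k) => k1 /=;
  rewrite !wact_cons wact_seq1 //.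
- by rewrite SA// (SS k j).
- by rewrite SA.
- by rewrite SA// SA.
Qed.

Lemma wak_h_field n t :
  - (2 *: \sum_(k \in [set: int]) wact (normal_order F [:: Was k; Wa (n - k)]) t)
  + hact n t = fwak_h A S b n t.
Proof.
rewrite [RHS]/= scaleNr; congr (- (2 *: _) + _).
rewrite -/(finsum _) (finsum_reflect _ n); apply: eq_finsum => l.
by rewrite -normal_order2E subKr.
Qed.

Let nop_as_as n t j : nop_term 0 S S n j t = S j (S (n - j) t).
Proof. by rewrite /nop_term weyl_asas if_same. Qed.

Let fnop_as_as n t : fnop S S n t = finsum (fun j => S j (S (n - j) t)).
Proof. by apply: eq_finsum => j; apply: nop_as_as. Qed.

Let finsupported_as_as n t : finsupported (fun j => S j (S (n - j) t)).
Proof.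
by have [B HB] := finsupported_nop 0 S S n t; exists B => j /HB <-.
Qed.

(** The nested product sums first over the index of a, then over one index of a*; the given sum runs
    over both indices of a*. A finite box justifies the passage to iterated sums. *)
Lemma wak_f_cubic n t :
  \sum_(k \in [set: int * int])
     wact (normal_order F [:: Was k.1; Was k.2; Wa (n - k.1 - k.2)]) t =
  fnop A (fnop S S) n t.
Proof.
pose f l j u := S j (S (n - l - j) u).
pose h (p : int * int) :=
  if (p.1 < 0)%O then A p.1 (f p.1 p.2 t) else f p.1 p.2 (A p.1 t).
transitivity (finsum h).
  (* The new coordinates are the index l of a and the index j of the first a*; the second a* gets n
     - l - j. *)
  pose r (p : int * int) : int * int := (p.2, n - p.1 - p.2).
  rewrite -/(finsum _) (@finsum_reindex _ _ _ _ r); last first.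
    by exists (fun p => (n - p.1 - p.2, p.1)) => -[x y]; rewrite /r /=;
      congr pair; lia.
  apply: eq_finsum => -[l j]; rewrite /r /= normal_order3E.
  by have -> : n - j - (n - l - j) = l by lia.
have [n0 AS0] := field_smooth2 A S t.
have [n1 S1] := field_smooth_family S (A ^~ t) 0 n0.
have fz l j u n2 : (forall k, (n2 <= k)%O -> S k u = 0) ->
    (n2 <= j)%O || (n2 <= n - l - j)%O -> f l j u = 0.
  move=> Su /orP[nj|nj]; rewrite /f; last by rewrite Su ?linear0.
  by rewrite weyl_asas Su ?linear0.
pose box lo hi := [fset (lo + i%:Z)%R | i in iota 0 `|hi - lo|%N]%fset.
(* In a non-zero term with l < 0 both indices of a* are below [n0] and add up to n - l. With l >= 0
   one has l < [n0], and both are below [n1], a bound common to the finitely many vectors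
   [A l t]. *)
rewrite (@finsum_pair _ _ _ _ h (box (Num.min 0 (n - n0 - n0)) (Num.max 0 n0))
  (box (Num.min (n - n0) (n - n0 - n1)) (Num.max n0 n1))).
  apply: eq_finsum => l; rewrite [RHS]/nop_term; case l0: (l < 0)%O.
    transitivity (finsum (fun j => A l (f l j t))).
      by apply: eq_finsum => j; rewrite /h /= l0.
    by rewrite fnop_as_as finsum_linear//; apply: finsupported_as_as.
  by rewrite fnop_as_as; apply: eq_finsum => j; rewrite /h /= l0.
move=> l j out; rewrite /h /=; case: ltP => l0.
  have [jn|jn] := boolP ((n0 <= j)%O || (n0 <= n - l - j)%O).
    rewrite (fz _ _ _ n0); [exact/linear_fun0/wact_linear|by move=> k /AS0[]|by []].
  by move: out; rewrite !mem_int_interval//; lia.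
have [ln|ln] := leP n0 l; first by rewrite [wact _ t](AS0 _ ln).1 /f !linear0.
have [jn|jn] := boolP ((n1 <= j)%O || (n1 <= n - l - j)%O).
  by apply: (fz _ _ _ n1) => // k kn1; apply: S1.
by move: out; rewrite !mem_int_interval//; lia.
Qed.

Lemma wak_f_field n t :
  - (\sum_(k \in [set: int * int])
       wact (normal_order F [:: Was k.1; Was k.2; Wa (n - k.1 - k.2)]) t)
  + (kappa * (- n)%:~R) *: wact (g (Was n)) t
  + (\sum_(k \in [set: int]) wact (g (Was k)) (hact (n - k) t)) =
  fwak_f kappa A S b n t.
Proof.
rewrite wak_f_cubic [RHS]/= scaleN1r -addrA; congr (- _ + (_ + _)).
  by rewrite scalerA intrN mulrN mulNr.
apply: eq_finsum => k; rewrite /nop_term /= wact_hact; case: ifP => //.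
Qed.

End WeylHeisenbergModule.

(** * The action of the affine Lie algebra *)

Section AffineAction.
Variables (F : comNzRingType) (kappa : F) (T : lmodType F) (A S b : qfield T).
Hypotheses (AA : fcomm A A) (SS : fcomm S S) (Ab : fcomm A b) (Sb : fcomm S b)
  (AS : forall n m t, A n (S m t) = S m (A n t) + fone T (n + m) t)
  (bb : forall n m t, b n (b m t) =
    b m (b n t) + (2 * (kappa + 2) * n%:~R) *: fone T (n + m) t)
  (two_inj : forall u : T, u + u = 0 -> u = 0).

Let H := fwak_h A S b.
Let Ff := fwak_f kappa A S b.

Definition affine_basis_act (s : affine_basis) (t : T) : T :=
  match s with
  | None => kappa *: t
  | Some (SE, n) => A n t
  | Some (SH, n) => H n t
  | Some (SF, n) => Ff n t
  end.

Variable rho : affine F -> T -> T.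
Hypothesis rhoE : forall x t,
  rho x t = \sum_(s <- msupp x) x@_s *: affine_basis_act s t.

Local Notation rb := affine_basis_act.

Let rb_linear s : linear (rb s).
Proof.
case: s => [[[] n]|]; try exact: fmode_linear.
move=> a u v /=; by rewrite scalerDr !scalerA mulrC.
Qed.

Let rhoEw (d : {fset affine_basis}) x t : (msupp x `<=` d)%fset ->
  rho x t = \sum_(s <- d) x@_s *: rb s t.
Proof.
move=> le; rewrite rhoE (big_fset_incl _ le) //= => k _ /mcoeff_outdom ->.
by rewrite scale0r.
Qed.

Lemma affine_act_linearl t : linear (rho^~ t).
Proof.
move=> a u v; set d := (msupp (a *: u + v) `|` msupp u `|` msupp v)%fset.
rewrite 3?(@rhoEw d); first last.
- by rewrite /d -fsetUA fsubsetUl.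
- by rewrite /d -fsetUA fsubsetU // fsubsetUl orbT.
- by rewrite /d fsubsetUr.
rewrite scaler_sumr -big_split; apply: eq_bigr => k _ /=.
by rewrite mcoeffD mcoeffZ scalerDl scalerA.
Qed.

Lemma affine_act_linearr x : linear (rho x).
Proof.
move=> a u v; rewrite !rhoE scaler_sumr -big_split; apply: eq_bigr => k _ /=.
by rewrite rb_linear scalerDr !scalerA mulrC.
Qed.

Lemma affine_act_basis s t : rho << s >> t = rb s t.
Proof. by rewrite (rhoEw _ msuppU_le) big_seq_fset1 mcoeffUU scale1r. Qed.

Lemma affine_act_mode x n t : rho (mode F x n) t = rb (Some (x, n)) t.
Proof. exact: affine_act_basis. Qed.

Lemma affine_act_K t : rho (Kc F) t = kappa *: t.
Proof. exact: affine_act_basis. Qed.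

Let rho_lin t a u v : rho (a *: u + v) t = a *: rho u t + rho v t.
Proof. exact: affine_act_linearl. Qed.
Let rhoD t u v : rho (u + v) t = rho u t + rho v t.
Proof. by rewrite -[u in LHS]scale1r rho_lin scale1r. Qed.
Let rho0 t : rho 0 t = 0.
Proof. exact: linear_fun0 (affine_act_linearl t). Qed.
Let rhoZ t a u : rho (a *: u) t = a *: rho u t.
Proof. by rewrite -[a *: u]addr0 rho_lin rho0 addr0. Qed.
Let rhoN t u : rho (- u) t = - rho u t.
Proof. by rewrite -[- u]scaleN1r rhoZ scaleN1r. Qed.

Lemma affine_act_bracket_basis s1 s2 t :
  rho (bracket_basis F s1 s2) t = rb s1 (rb s2 t) - rb s2 (rb s1 t).
Proof.
have he n m u : H n (A m u) - A m (H n u) = 2 *: A (n + m) u.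
  exact (fwak_he AA Ab AS n m u).
have ef n m u : A n (Ff m u) - Ff m (A n u) =
    H (n + m) u + (kappa * n%:~R) *: ((n + m == 0)%:R *: u).
  exact (fwak_ef kappa AA Ab AS n m u).
have hh n m u : H n (H m u) - H m (H n u) =
    (2 * kappa * n%:~R) *: ((n + m == 0)%:R *: u).
  exact (fwak_hh AA SS Ab Sb AS bb n m u).
have hf n m u : H n (Ff m u) - Ff m (H n u) = (-2) *: Ff (n + m) u.
  exact (fwak_hf AA SS Ab Sb AS bb n m u).
have ff n m u : Ff n (Ff m u) - Ff m (Ff n u) = 0.
  exact (fwak_ff AA SS Ab Sb AS bb two_inj n m u).
have rbZ s u : rb s (kappa *: u) = kappa *: rb s u.
  by rewrite -[kappa *: u]addr0 rb_linear (linear_fun0 (rb_linear s)) addr0.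
case: s1 => [[x n]|]; last by rewrite /bracket_basis rho0 [rb None _]/= rbZ subrr.
case: s2 => [[y m]|]; last by rewrite /bracket_basis rho0 [rb None _]/= rbZ subrr.
rewrite /bracket_basis.
rewrite rhoD rhoZ affine_act_K.
have nm : m + n = n + m by exact: addrC.
have mnE : (kappa * m%:~R) *: ((n + m == 0)%:R *: t) =
    - ((kappa * n%:~R) *: ((n + m == 0)%:R *: t)).
  rewrite -nm; case: (m + n =P 0) => [/eqP|_]; last by rewrite scale0r !scaler0 oppr0.
  by rewrite addr_eq0 => /eqP ->; rewrite intrN mulrN scaleNr.
(* The brackets of e with h, f with e and f with h follow from the opposite ones by antisymmetry;
   [mnE] adjusts the central term for f with e. *)
case: x; case: y; rewrite [sl2_bracket _ _ _]/= [sl2_form _ _ _]/= ?rhoN ?rhoZ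
  ?affine_act_mode ?rho0 /affine_basis_act.
- by rewrite AA; lmod F.
- by rewrite -[RHS]opprB he nm; lmod F.
- by rewrite ef; lmod F.
- by rewrite he; lmod F.
- by rewrite hh; lmod F.
- by rewrite hf; lmod F.
- by rewrite -[RHS]opprB ef nm mnE; lmod F.
- by rewrite -[RHS]opprB hf nm; lmod F.
- by rewrite ff; lmod F.
Qed.

Lemma affine_act_bracket x y t :
  rho (bracket x y) t = rho x (rho y t) - rho y (rho x t).
Proof.
have -> : rho (bracket x y) t = \sum_(s1 <- msupp x) \sum_(s2 <- msupp y)
    (x@_s1 * y@_s2) *: (rb s1 (rb s2 t) - rb s2 (rb s1 t)).
  rewrite /bracket (big_morph _ (rhoD t) (rho0 t)); apply: eq_bigr => s1 _.
  rewrite (big_morph _ (rhoD t) (rho0 t)); apply: eq_bigr => s2 _.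
  by rewrite rhoZ affine_act_bracket_basis.
have rr u v : rho u (rho v t) = \sum_(s1 <- msupp u) \sum_(s2 <- msupp v)
    (u@_s1 * v@_s2) *: rb s1 (rb s2 t).
  rewrite rhoE; apply: eq_bigr => s1 _; rewrite (rhoE v).
  have rD a1 a2 : rb s1 (a1 + a2) = rb s1 a1 + rb s1 a2.
    by rewrite -[a1 in LHS]scale1r rb_linear scale1r.
  rewrite (big_morph _ rD (linear_fun0 (rb_linear s1))) scaler_sumr.
  apply: eq_bigr => s2 _; rewrite -[_ *: rb s2 t]addr0 rb_linear.
  by rewrite (linear_fun0 (rb_linear s1)) addr0 scalerA.
rewrite !rr [X in _ = _ - X]exchange_big /= -sumrB; apply: eq_bigr => s1 _.
rewrite -sumrB; apply: eq_bigr => s2 _.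
by rewrite scalerBr [y@_s2 * _]mulrC.
Qed.

Lemma affine_act_smooth : smooth_module kappa rho.
Proof.
split.
- exact: affine_act_linearr.
- exact: affine_act_linearl.
- exact: affine_act_bracket.
- exact: affine_act_K.
move=> v c; have [n0 EH] := field_smooth2 A H v.
have [n1 Fn] := fmode_smooth Ff v; exists (Num.max n0 n1) => n nn.
have mode0 x : rho (mode F x n) v = 0.
  have n0n : (n0 <= n)%O by lia.
  by rewrite affine_act_mode; case: x;
    [exact: (EH n n0n).1|exact: (EH n n0n).2|apply: Fn; lia].
have spanv (a : F) (y z : affine F) :
    rho y v = 0 -> rho z v = 0 -> rho (a *: y + z) v = 0.
  by move=> y0 z0; rewrite rho_lin y0 z0 scaler0 addr0.
rewrite /sl2_mode -addrA -[c SF *: _]addr0.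
apply: (spanv) => //; apply: (spanv) => //; apply: (spanv) => //.
Qed.

End AffineAction.

(* The Fock-type module used to see that vacuum vectors are non-zero: on
   functions of exponents [X -> nat], a creator [y] multiplies by a variable
   and an annihilator [x] shifts the exponent of the creator [s x] dual to it. *)
Section VacuumFunctional.
Variables (F : comNzRingType) (X : choiceType) (c : X -> X -> F).
Variables (D : pred X) (chi : X -> F) (s : X -> X) (d : X -> F).
Hypotheses (cN : forall x y, c y x = - c x y)
  (cDD : forall x y, D x -> D y -> c x y = 0)
  (cNN : forall x y, ~~ D x -> ~~ D y -> c x y = 0)
  (cDN : forall x y, D x -> ~~ D y -> c x y = d x * (y == s x)%:R).

Local Notation expo := (X -> nat).
Local Notation fock := (expo -> F).

Definition expo_incr (y : X) (m : expo) : expo := fun z => (m z + (z == y))%N.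
Definition expo_decr (y : X) (m : expo) : expo := fun z => (m z - (z == y))%N.

(** Here f(m) is the coefficient of the divided power t^m / m!: multiplication by a variable brings
    in the factor m, and differentiation is a plain shift. No division occurs, and arbitrary
    functions of m are allowed. *)
Definition fock_act (x : X) (f : fock) : fock := fun m =>
  if D x then chi x * f m + d x * f (expo_incr (s x) m)
  else (m x)%:R * f (expo_decr x m).

Lemma fock_comm x y f m :
  fock_act x (fock_act y f) m - fock_act y (fock_act x f) m = c x y * f m.
Proof.
have incrC a b : expo_incr a (expo_incr b m) = expo_incr b (expo_incr a m).
  by apply: boolp.funext => z; rewrite /expo_incr; lia.
have mixed a b : D a -> ~~ D b ->
    fock_act a (fock_act b f) m - fock_act b (fock_act a f) m = c a b * f m.
  move=> Da Db; rewrite /fock_act Da (negbTE Db) cDN// /expo_incr.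
  have [->|bs] := eqVneq b (s a).
    have -> : expo_decr (s a) (fun z => m z + (z == s a))%N = m.
      by apply: boolp.funext => z; rewrite /expo_decr; lia.
    (* At exponent 0 the truncated decrement is not undone by the increment, but the factor
       [m (s a)] is 0 there. *)
    have [m0|m0] := posnP (m (s a)); first by rewrite m0 add0n; ring.
    have -> : (fun z => expo_decr (s a) m z + (z == s a))%N = m.
      apply: boolp.funext => z; rewrite /expo_decr.
      by have [->|] := eqVneq z (s a); lia.
    by rewrite natrD; ring.
  have -> : (fun z => expo_decr b m z + (z == s a))%N =
      expo_decr b (fun z => m z + (z == s a))%N.
    apply: boolp.funext => z; rewrite /expo_decr.
    by have [->|_] := eqVneq z b; rewrite ?(negbTE bs) ?addn0// !subn0.
  by rewrite addn0 [_%:R in RHS]/=; ring.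
have [Dx|Dx] := boolP (D x); have [Dy|Dy] := boolP (D y).
- by rewrite cDD// /fock_act Dx Dy incrC; ring.
- exact: mixed.
- by rewrite cN mulNr -mixed// opprB.
rewrite cNN// /fock_act (negbTE Dx) (negbTE Dy) mul0r.
have [->|xy] := eqVneq x y; first by rewrite subrr.
have -> : expo_decr x (expo_decr y m) = expo_decr y (expo_decr x m).
  by apply: boolp.funext => z; rewrite /expo_decr; lia.
rewrite /expo_decr (negbTE xy) eq_sym (negbTE xy) !subn0; ring.
Qed.

Lemma fock_act_linear x (a : F) (f h : fock) m :
  fock_act x (fun k => a * f k + h k) m = a * fock_act x f m + fock_act x h m.
Proof. by rewrite /fock_act; case: ifP => _; ring. Qed.

Definition fock_vac : fock := fun m => if `[< forall z, m z = 0%N >] then 1 else 0.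

Lemma fock_act_vac x : D x -> fock_act x fock_vac = (fun m => chi x * fock_vac m).
Proof.
move=> Dx; apply: boolp.funext => m; rewrite /fock_act Dx /fock_vac.
have -> : `[< forall z, expo_incr (s x) m z = 0%N >] = false.
  by apply/asboolP => /(_ (s x)); rewrite /expo_incr eqxx addn1.
by rewrite mulr0 addr0.
Qed.

Definition fock_word (w : seq X) (f : fock) : fock := foldr fock_act f w.

Definition fock_free (u : freealg F X) (f : fock) : fock := fun m =>
  malg_ext (fun k : {fmonom X} => fock_word k f m) u.

Lemma fock_act_sum x (I : Type) (r : seq I) (a : I -> F) (f : I -> fock) m :
  fock_act x (fun k => \sum_(i <- r) a i * f i k) m =
  \sum_(i <- r) a i * fock_act x (f i) m.
Proof.
elim: r => [|i r IH].
  have -> : (fun k => \sum_(i <- [::]) a i * f i k) = fun=> 0.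
    by apply: boolp.funext => k; rewrite big_nil.
  by rewrite big_nil /fock_act !mulr0 addr0 if_same.
rewrite big_cons -IH -fock_act_linear; congr (fock_act x _ m).
by apply: boolp.funext => k; rewrite big_cons.
Qed.

Lemma fock_word_sum w (I : Type) (r : seq I) (a : I -> F) (f : I -> fock) m :
  fock_word w (fun k => \sum_(i <- r) a i * f i k) m =
  \sum_(i <- r) a i * fock_word w (f i) m.
Proof.
elim: w m => [//|x w IH] m /=; rewrite -fock_act_sum; congr (fock_act x _ m).
by apply: boolp.funext => k; rewrite IH.
Qed.

Lemma fock_word_free w u f m :
  fock_word w (fock_free u f) m =
  malg_ext (fun k : {fmonom X} => fock_word w (fock_word k f) m) u.
Proof. exact: fock_word_sum. Qed.

(** Both sides are linear in u and in v, and on words the product is concatenation. *)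
Lemma fock_freeM u v f : fock_free (u * v) f = fock_free u (fock_free v f).
Proof.
apply: boolp.funext => m.
pose l1 (u : freealg F X) : F^o := fock_free (u * v) f m.
pose l2 (u : freealg F X) : F^o := fock_free u (fock_free v f) m.
have lin2 : linear l2 by exact: malg_ext_linear.
have lin1 : linear l1.
  by move=> a y z; rewrite /l1 mulrDl -scalerAl; apply: malg_ext_linear.
apply: (malg_ind (subspace_eq_linear lin1 lin2)) => k.
rewrite /= /l1 /l2 [RHS]malg_ext_basis fock_word_free.
pose l3 (v : freealg F X) : F^o := fock_free (<< k >> * v) f m.
have lin3 : linear l3.
  by move=> a y z; rewrite /l3 mulrDr -freealg_scaleAr; apply: malg_ext_linear.
apply: (malg_ind (subspace_eq_linear lin3
  (malg_ext_linear (fun k' : {fmonom X} => fock_word k (fock_word k' f) m)))) => k'.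
rewrite /= /l3 malg_ext_basis malgM_def fgmulUU mulr1 /fock_free malg_ext_basis.
by rewrite fmM /fock_word foldr_cat.
Qed.

Lemma fock_free_var x f : fock_free (var F x) f = fock_act x f.
Proof.
by apply: boolp.funext => m; rewrite /fock_free malg_ext_basis fmuE.
Qed.

Lemma fock_free1 f : fock_free 1 f = f.
Proof. by apply: boolp.funext => m; rewrite /fock_free malg_ext_basis fm1. Qed.

Lemma fock_word0 w : fock_word w (fun=> 0) = fun=> 0.
Proof.
elim: w => //= x w ->; apply: boolp.funext => m.
by rewrite /fock_act !mulr0 addr0 if_same.
Qed.

Lemma fock_free0r u : fock_free u (fun=> 0) = fun=> 0.
Proof.
apply: boolp.funext => m; rewrite /fock_free /malg_ext big1// => k _.
by rewrite fock_word0 mulr0.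
Qed.

Lemma fock_free_relation x y f :
  fock_free (var F x * var F y - var F y * var F x - (c x y)%:A) f = fun=> 0.
Proof.
apply: boolp.funext => m.
have L a (u v : freealg F X) :
    fock_free (a *: u + v) f m = a * fock_free u f m + fock_free v f m.
  exact: malg_ext_linear.
have -> : var F x * var F y - var F y * var F x - (c x y)%:A =
    (- c x y) *: 1 + ((-1) *: (var F y * var F x) + var F x * var F y).
  by rewrite scaleN1r scaleNr addrC; congr (_ + _); rewrite addrC.
have M x1 x2 : fock_free (var F x1 * var F x2) f m = fock_act x1 (fock_act x2 f) m.
  by rewrite fock_freeM !fock_free_var.
rewrite [LHS]L [X in _ + X]L [X in _ * X + _](congr1 (@^~ m) (fock_free1 f)).
rewrite [X in _ + (_ * X + _)](M y x) [X in _ + (_ + X)](M x y).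
rewrite mulNr -(fock_comm x y f m).
by ring.
Qed.

Lemma fock_free_ideal u f : u \in spanp (ideal_gens (ccr_relations c)) ->
  fock_free u f = fun=> 0.
Proof.
move=> uI; apply: boolp.funext => m; move: u uI.
apply: spanp_min => [|_ [u [_ [v [[x [y ->]] ->]]]]] /=.
  apply: (subspace_eq_linear (@malg_ext_linear F {fmonom X}
    (fun k : {fmonom X} => fock_word k f m))).
  by move=> a y z; rewrite scaler0 addr0.
by rewrite !fock_freeM fock_free_relation fock_free0r.
Qed.

Definition fock_ccr (a : ccr c) (f : fock) : fock := fock_free (qrepr _ a) f.

Lemma fock_ccrE u f : fock_ccr (aproj _ u) f = fock_free u f.
Proof.
apply: boolp.funext => m; rewrite /fock_ccr.
have := fock_free_ideal f (qreprP _ u); set r := qrepr _ _.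
have -> : r - u = (-1) *: u + r by rewrite scaleN1r addrC.
move/(congr1 (fun h : fock => h m)).
rewrite [LHS](malg_ext_linear _ (-1) u r) scaleN1r addrC => /eqP.
by rewrite subr_eq0 => /eqP.
Qed.

Lemma fock_ccr_linear f m : linear (fun a => fock_ccr a f m : F^o).
Proof.
move=> a x y; rewrite -[x]aprojK -[y]aprojK -aprojZ -aprojD !fock_ccrE.
exact: malg_ext_linear.
Qed.

Lemma fock_ccrM x y f : fock_ccr (x * y) f = fock_ccr x (fock_ccr y f).
Proof. by rewrite -[x]aprojK -[y]aprojK -aprojM !fock_ccrE fock_freeM. Qed.

Lemma fock_ccr_gen x f : fock_ccr (gen c x) f = fock_act x f.
Proof. by rewrite fock_ccrE fock_free_var. Qed.

Lemma fock_ccr1 f : fock_ccr 1 f = f.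
Proof. by rewrite -aproj1 fock_ccrE fock_free1. Qed.

Lemma fock_ccr0r u : fock_ccr u (fun=> 0) = fun=> 0.
Proof. exact: fock_free0r. Qed.

Lemma fock_ccr_vac u : u \in spanp (left_ideal_gens
    (whit_relations (c := c) (fun x => D x : Prop) chi)) ->
  fock_ccr u fock_vac = fun=> 0.
Proof.
move=> uI; apply: boolp.funext => m; move: u uI.
apply: spanp_min => [|_ [u [_ [[x [Dx ->]] ->]]]] /=.
  apply: (subspace_eq_linear (fock_ccr_linear fock_vac m)).
  by move=> a y z; rewrite scaler0 addr0.
rewrite fock_ccrM.
suff -> : fock_ccr (gen c x - chi x *: (1 : ccr c)) fock_vac = fun=> 0.
  by rewrite fock_ccr0r.
apply: boolp.funext => k.
have -> : gen c x - chi x *: (1 : ccr c) = (- chi x) *: (1 : ccr c) + gen c x.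
  by rewrite scaleNr addrC.
rewrite [LHS](fock_ccr_linear _ k (- chi x) 1 (gen c x)) fock_ccr1 fock_ccr_gen.
by rewrite fock_act_vac// scaleNr addNr.
Qed.

Local Notation whit := (whit c (fun x => D x : Prop) chi).

(** The constant term of the result of acting on the constant 1. It descends to the quotient because
    the defining left ideal annihilates that constant. *)
Definition vac_coef (m : whit) : F^o := fock_ccr (qrepr _ m) fock_vac (fun=> 0%N).

Lemma vac_coefE u : vac_coef (qproj _ u) = fock_ccr u fock_vac (fun=> 0%N).
Proof.
rewrite /vac_coef; have := fock_ccr_vac (qreprP _ u); set r := qrepr _ _.
have -> : r - u = (-1) *: u + r by rewrite scaleN1r addrC.
move/(congr1 (fun h : fock => h (fun=> 0%N))).
rewrite [LHS](fock_ccr_linear _ _ (-1) u r) scaleN1r addrC => /eqP.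
by rewrite subr_eq0 => /eqP.
Qed.

Lemma vac_coef_linear : linear vac_coef.
Proof.
move=> a x y; rewrite -[x]qreprK -[y]qreprK.
rewrite -linearP !vac_coefE; exact: fock_ccr_linear.
Qed.

Lemma vac_coef_vac : vac_coef (whit_vec c (fun x => D x : Prop) chi) = 1.
Proof.
rewrite /whit_vec vac_coefE fock_ccr1 /fock_vac.
by case: asboolP => // -[].
Qed.

End VacuumFunctional.

(** * Weyl and Heisenberg actions on the tensor product *)

Section TensorProductModule.
Variables (F : comNzRingType) (kappa : F) (V W : lmodType F).
Variables (act_weyl : weyl F -> V -> V) (act_heis : int -> W -> W).
Local Notation g := (gen (@weyl_comm F)).
Hypotheses (act_weyl_linear : forall u, linear (act_weyl u))
  (act_weylM : forall u v m, act_weyl (u * v) m = act_weyl u (act_weyl v m))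
  (act_weyl_comm : forall x y m, act_weyl (g x) (act_weyl (g y) m) =
     act_weyl (g y) (act_weyl (g x) m) + weyl_comm F x y *: m)
  (act_heis_linear : forall n, linear (act_heis n))
  (act_heis_comm : forall n k m, act_heis n (act_heis k m) =
     act_heis k (act_heis n m) + heis_comm kappa n k *: m).
Hypotheses
  (a_smooth : forall m, exists n0 : int, forall n, (n0 <= n)%O ->
     act_weyl (g (Wa n)) m = 0)
  (as_smooth : forall m, exists n0 : int, forall n, (n0 <= n)%O ->
     act_weyl (g (Was n)) m = 0)
  (b_smooth : forall m, exists n0 : int, forall n, (n0 <= n)%O ->
     act_heis n m = 0).

Local Notation T := (tensor V W).
Local Notation wact := (weyl_act (W := W) act_weyl).
Local Notation hact := (heis_act (V := V) act_heis).

Let id_linear (U : lmodType F) : linear (@id U). Proof. by []. Qed.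

Lemma weyl_act_linear u : linear (wact u).
Proof. exact: tmap_linear. Qed.

Lemma heis_act_linear n : linear (hact n).
Proof. exact: tmap_linear. Qed.

Lemma weyl_act_tens u v w : wact u (tens v w) = tens (act_weyl u v) w.
Proof. exact: tmap_tens. Qed.

Lemma heis_act_tens n v w : hact n (tens v w) = tens v (act_heis n w).
Proof. exact: tmap_tens. Qed.

Let tens0l w : tens 0 w = 0 :> T.
Proof.
by have := @tens_linearl F V W (-1) 0 0 w; rewrite scaler0 addr0 scaleN1r addNr.
Qed.

Let tens0r v : tens v 0 = 0 :> T.
Proof.
by have := @tens_linearr F V W (-1) v 0 0; rewrite scaler0 addr0 scaleN1r addNr.
Qed.

Lemma weyl_actM u v t : wact (u * v) t = wact u (wact v t).
Proof.
move: t; apply: tens_ind => [|v1 w]; last by rewrite !weyl_act_tens act_weylM.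
apply: subspace_eq_linear => [|a x y]; first exact: weyl_act_linear.
by rewrite !weyl_act_linear.
Qed.

Lemma weyl_act_commutator x y t :
  wact (g x) (wact (g y) t) = wact (g y) (wact (g x) t) + weyl_comm F x y *: t.
Proof.
move: t; apply: tens_ind => [|v w]; last first.
  by rewrite !weyl_act_tens act_weyl_comm addrC tens_linearl addrC.
apply: (@subspace_eq_linear _ _ _ (fun t => wact (g x) (wact (g y) t))
  (fun t => wact (g y) (wact (g x) t) + weyl_comm F x y *: t)) => a u v.
  by rewrite !weyl_act_linear.
by rewrite !weyl_act_linear; lmod F.
Qed.

Lemma heis_act_commutator n k t :
  hact n (hact k t) = hact k (hact n t) + heis_comm kappa n k *: t.
Proof.
move: t; apply: tens_ind => [|v w]; last first.
  by rewrite !heis_act_tens act_heis_comm addrC tens_linearr addrC.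
apply: (@subspace_eq_linear _ _ _ (fun t => hact n (hact k t))
  (fun t => hact k (hact n t) + heis_comm kappa n k *: t)) => a u v.
  by rewrite !heis_act_linear.
by rewrite !heis_act_linear; lmod F.
Qed.

Lemma weyl_heis_act_comm u n t : wact u (hact n t) = hact n (wact u t).
Proof.
move: t; apply: tens_ind => [|v w].
  by apply: subspace_eq_linear => a x y; rewrite !(weyl_act_linear, heis_act_linear).
by rewrite weyl_act_tens !heis_act_tens weyl_act_tens.
Qed.

Lemma weyl_act_smooth (x : int -> weyl_gen) :
    (forall m, exists n0 : int, forall n, (n0 <= n)%O ->
       act_weyl (g (x n)) m = 0) ->
  forall t, exists n0 : int, forall n, (n0 <= n)%O -> wact (g (x n)) t = 0.
Proof.
move=> x0; apply: (tens_ind (smooth_subspace (fun n => weyl_act_linear (g (x n))))).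
move=> v w /=; have [n0 n0P] := x0 v.
by exists n0 => n /n0P; rewrite weyl_act_tens => ->; apply: tens0l.
Qed.

Lemma heis_act_smooth t : exists n0 : int, forall n, (n0 <= n)%O -> hact n t = 0.
Proof.
move: t; apply: (tens_ind (smooth_subspace heis_act_linear)) => v w /=.
have [n0 n0P] := b_smooth w.
by exists n0 => n /n0P; rewrite heis_act_tens => ->; apply: tens0r.
Qed.

Definition tensor_a : qfield T :=
  weyl_a_field weyl_act_linear (weyl_act_smooth a_smooth).
Definition tensor_as : qfield T :=
  weyl_as_field weyl_act_linear (weyl_act_smooth as_smooth).
Definition tensor_b : qfield T := heis_field heis_act_linear heis_act_smooth.

Lemma wakimoto_actE x t : wakimoto_act kappa act_weyl act_heis x t =
  \sum_(s <- msupp x) x@_s *: affine_basis_act kappa tensor_a tensor_as tensor_b s t.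
Proof.
apply: eq_bigr => s _; congr (_ *: _); case: s => [[[] n]|]; [by []| | |by []].
  exact: (wak_h_field weyl_act_linear weyl_actM weyl_act_commutator
    heis_act_linear (weyl_act_smooth a_smooth) (weyl_act_smooth as_smooth)
    heis_act_smooth n t).
exact: (wak_f_field kappa weyl_act_linear weyl_actM weyl_act_commutator
  heis_act_linear weyl_heis_act_comm (weyl_act_smooth a_smooth)
  (weyl_act_smooth as_smooth) heis_act_smooth n t).
Qed.

End TensorProductModule.

(** * The Whittaker function and the cyclic submodule *)

Section WhittakerCharacter.
Variables (F : comNzRingType) (kappa : F) (V : lmodType F).
Variables (rho : affine F -> V -> V) (w : V) (phi : V -> F^o) (q r : nat).
Variables (ev_e ev_h ev_f : nat -> F).
Hypotheses (rho_smooth : smooth_module kappa rho)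
  (phi_linear : linear phi) (phi_w : phi w = 1)
  (rho_e : forall i : nat, rho (mode F SE i) w = ev_e i *: w)
  (rho_h : forall i : nat, rho (mode F SH (q + i)%N) w = ev_h i *: w)
  (rho_f : forall i : nat, rho (mode F SF (r + i)%N) w = ev_f i *: w).

Let rho_l v : linear (rho^~ v). Proof. by case: rho_smooth. Qed.
Let rho_r x : linear (rho x). Proof. by case: rho_smooth. Qed.

Let phiZ a : phi (a *: w) = a.
Proof.
by rewrite -[a *: w]addr0 phi_linear phi_w linear_fun0// addr0 [LHS]mulr1.
Qed.

Let rhoZ x a v : rho x (a *: v) = a *: rho x v.
Proof. by rewrite -[a *: v]addr0 rho_r linear_fun0// addr0. Qed.

Definition is_whittaker_function (psi : Pqr F q r -> F) : Prop :=
  [/\ lie_character psi, psi (PK q r) = kappa,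
      forall i, psi (Pe q r i) = ev_e i,
      forall i, psi (Ph q r i) = ev_h i
    & forall i, psi (Pf q r i) = ev_f i].

(** Since [phi w = 1], the form reads off the coefficient of any multiple of w. *)
Definition whittaker_eigenvalue (x : Pqr F q r) : F := phi (rho (val x) w).

(** The elements that have w as an eigenvector form a subspace closed under brackets, as the
    commutator of two of them kills w; it contains the generators of P_{q,r}. *)
Lemma whittaker_eigenvalueE : whittaker_vector whittaker_eigenvalue rho w.
Proof.
suff E (z : affine F) : z \in @Pqr_pred F q r -> rho z w = phi (rho z w) *: w.
  by move=> x; apply: E; apply: valP.
move=> /asboolP/(_ [set y | rho y w = phi (rho y w) *: w]%classic); apply.
- have e0 : rho 0 w = 0 by exact: linear_fun0 (rho_l w).
  split=> [|a x y ex ey] /=; first by rewrite e0 linear_fun0// scale0r.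
  rewrite (rho_l w a x y) ex ey scalerA -scalerDl.
  by rewrite !phiZ.
- move=> x y /= ex ey; suff -> : rho (bracket x y) w = 0.
    by rewrite linear_fun0// scale0r.
  case: rho_smooth => _ _ /(_ x y w) -> _ _.
  move: (phi _) (phi _) ex ey => a b ex ey.
  by rewrite ey rhoZ ex rhoZ ey !scalerA mulrC subrr.
move=> _ [->|[n ->]|[m [qm ->]]|[p [rp ->]]] /=.
- by case: rho_smooth => _ _ _ -> _; rewrite phiZ.
- by rewrite rho_e phiZ.
- by rewrite -(subnKC qm) rho_h phiZ.
- by rewrite -(subnKC rp) rho_f phiZ.
Qed.

Lemma whittaker_eigenvalue_function : is_whittaker_function whittaker_eigenvalue.
Proof.
split.
- split=> [a x y|x y]; rewrite /whittaker_eigenvalue.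
    by rewrite linearP (rho_l w) phi_linear.
  case: rho_smooth => _ _ /(_ (val x) (val y) w) -> _ _.
  rewrite !whittaker_eigenvalueE !rhoZ !whittaker_eigenvalueE.
  by rewrite !scalerA mulrC subrr linear_fun0.
- by rewrite /whittaker_eigenvalue; case: rho_smooth => _ _ _ -> _; rewrite phiZ.
- by move=> i; rewrite /whittaker_eigenvalue rho_e phiZ.
- by move=> i; rewrite /whittaker_eigenvalue rho_h phiZ.
- by move=> i; rewrite /whittaker_eigenvalue rho_f phiZ.
Qed.

(** Two characters agree on the generators by assumption, and on every bracket because both vanish
    there. *)
Lemma whittaker_function_unique psi psi' :
  is_whittaker_function psi -> is_whittaker_function psi' -> psi = psi'.
Proof.
move=> [[psiL psiB] psiK psie psih psif] [[psiL' psiB'] psiK' psie' psih' psif'].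
have psi_irr (psi0 : Pqr F q r -> F) (y : affine F) (p p' : y \in @Pqr_pred F q r) :
    psi0 (exist _ y p) = psi0 (exist _ y p').
  by congr psi0; apply: val_inj.
have agree (y : affine F) : y \in @Pqr_pred F q r ->
    forall p, psi (exist _ y p) = psi' (exist _ y p).
  (* Minimality of [Pqr_pred] concerns sets of affine elements, so membership is carried along
     existentially. *)
  suff agree_ex : y \in @Pqr_pred F q r ->
      exists p : y \in @Pqr_pred F q r, psi (exist _ y p) = psi' (exist _ y p).
    move=> /agree_ex[p E] p'; rewrite (psi_irr psi _ p' p) E; exact: psi_irr.
  move=> /asboolP/(_ [set z | exists p : z \in @Pqr_pred F q r,
    psi (exist _ z p) = psi' (exist _ z p)]%classic); apply.
  - split=> [|a u v [pu Eu] [pv Ev]].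
      exists (Pqr_submod F q r).1.
      have -> : exist _ 0 (Pqr_submod F q r).1 = (0 : Pqr F q r) by apply: val_inj.
      have := psiL (-1) 0 0; have := psiL' (-1) 0 0.
      by rewrite scaler0 addr0 !mulN1r !addNr => -> ->.
    have p : a *: u + v \in @Pqr_pred F q r by apply: (Pqr_submod F q r).2.
    exists p.
    have -> : exist _ (a *: u + v) p = a *: (exist _ u pu : Pqr F q r) + exist _ v pv.
      by apply: val_inj.
    by rewrite psiL psiL' Eu Ev.
  - move=> u v [pu _] [pv _]; exists (Pqr_bracket_closed pu pv).
    transitivity (0 : F).
      by rewrite -[RHS](psiB (exist _ u pu) (exist _ v pv)); apply: psi_irr.
    by rewrite -[LHS](psiB' (exist _ u pu) (exist _ v pv)); apply: psi_irr.
  move=> _ [->|[n ->]|[m [qm ->]]|[p [rp ->]]] /=.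
  - by exists (PK_proof F q r); rewrite -/(PK q r) psiK psiK'.
  - by exists (Pe_proof F q r n); rewrite -/(Pe q r n) psie psie'.
  - rewrite -(subnKC qm); exists (Ph_proof F q r (m - q)).
    by rewrite -/(Ph q r (m - q)) psih psih'.
  - rewrite -(subnKC rp); exists (Pf_proof F q r (p - r)).
    by rewrite -/(Pf q r (p - r)) psif psif'.
by apply: boolp.funext => -[y p]; apply: agree.
Qed.

Lemma whittaker_function_ex1 : exists! psi, is_whittaker_function psi.
Proof.
exists whittaker_eigenvalue; split; first exact: whittaker_eigenvalue_function.
move=> psi'; apply: whittaker_function_unique.
exact: whittaker_eigenvalue_function.
Qed.

Lemma cyclic_smooth : smooth_module kappa (cyclic_act rho w).
Proof.
case: rho_smooth => _ _ rho_bracket rhoK rho_s; split.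
- by move=> x a u v; apply: val_inj; apply: rho_r.
- by move=> v a x y; apply: val_inj; apply: rho_l.
- by move=> x y v; apply: val_inj; apply: rho_bracket.
- by move=> v; apply: val_inj; apply: rhoK.
move=> v c; have [n0 n0P] := rho_s (val v) c.
by exists n0 => n /n0P E; apply: val_inj.
Qed.

Lemma cyclic_whittaker psi : is_whittaker_function psi ->
  generalized_whittaker_module kappa psi (cyclic_act rho w) (cyclic_vec rho w).
Proof.
move=> psiP; split.
- exact: cyclic_smooth.
- by case: psiP.
- apply/eqP => /(congr1 val) /= w0; have := phi_w; rewrite w0 linear_fun0//.
  by move/eqP; rewrite eq_sym oner_eq0.
- rewrite (whittaker_function_unique psiP whittaker_eigenvalue_function).
  by move=> x; apply: val_inj; apply: whittaker_eigenvalueE.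
case=> v vP; apply/asboolP => S [S0 SL] Sx Sw.
(* S is a set in the submodule, whereas membership of v is minimality in the ambient module; S is
   transported there. *)
suff [p Sp] : exists p : v \in cyclic rho w, S (exist _ v p).
  by rewrite (_ : exist _ v vP = exist _ v p)//; apply: val_inj.
move/asboolP: (vP) => /(_ [set z | exists p : z \in cyclic rho w,
  S (exist _ z p)]%classic); apply.
- split=> [|a x y [px Spx] [py Spy]].
    exists (cyclic_submod rho w).1.
    by rewrite (_ : exist _ 0 _ = (0 : cyclic_submodule rho w))//; apply: val_inj.
  have p : a *: x + y \in cyclic rho w by apply: (cyclic_submod rho w).2.
  exists p.
  have -> : exist _ (a *: x + y) p =
      a *: (exist _ x px : cyclic_submodule rho w) + exist _ y py.
    by apply: val_inj.
  exact: SL.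
- move=> x u [pu Su]; exists (cyclic_stable x pu).
  rewrite (_ : exist _ _ _ = cyclic_act rho w x (exist _ u pu)); first exact: Sx.
  by apply: val_inj.
- by exists (cyclic_gen rho w).
Qed.

End WhittakerCharacter.

(** * The Wakimoto action on the given Whittaker modules *)

Section WhittakerModules.
Variables (F : comNzRingType) (kappa : F) (lam mu eta : nat -> F) (N M P : nat).
Hypotheses (lam0 : forall i, (N < i)%N -> lam i = 0)
  (mu0 : forall i, (M < i)%N -> mu i = 0)
  (eta0 : forall i, (P < i)%N -> eta i = 0).

Lemma M1_a_smooth (m : M1 lam mu) : exists n0 : int, forall n, (n0 <= n)%O ->
  M1_act (gen (@weyl_comm F) (Wa n)) m = 0.
Proof.
apply: whit_smooth => [|[k|k]].
- by exists N.+1%:Z => -[] // n Nn; split=> //; apply: lam0.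
- by exists 0.
exists (1 - k) => n kn /=; have -> : (n + k == 0) = false by lia.
by [].
Qed.

Lemma M1_as_smooth (m : M1 lam mu) : exists n0 : int, forall n, (n0 <= n)%O ->
  M1_act (gen (@weyl_comm F) (Was n)) m = 0.
Proof.
apply: whit_smooth => [|[k|k]].
- exists M.+1%:Z => -[] // n Mn; split=> /=; first by lia.
  exact: mu0.
- exists (1 - k) => n kn /=; have -> : (k + n == 0) = false by lia.
  by rewrite oppr0.
by exists 0.
Qed.

Lemma N1_smooth (m : N1 kappa eta) : exists n0 : int, forall n, (n0 <= n)%O ->
  N1_act n m = 0.
Proof.
apply: (whit_smooth (x := id)) => [|k].
- by exists P.+1%:Z => -[] // n Pn; split=> //; apply: eta0.
exists (1 - k) => n kn; rewrite /heis_comm.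
have -> : (n + k == 0) = false by lia.
by rewrite mulr0.
Qed.

Local Notation V := (M1 lam mu).
Local Notation W := (N1 kappa eta).
Local Notation T := (tensor V W).
Local Notation w := (wakimoto_vec kappa lam mu eta).

Let act_weyl : weyl F -> V -> V := @M1_act F lam mu.
Let act_heis : int -> W -> W := @N1_act F kappa eta.

Let act_weyl_linear u : linear (act_weyl u).
Proof. exact: wact_linear. Qed.
Let act_heis_linear n : linear (act_heis n).
Proof. exact: wact_linear. Qed.
Let act_weylM u v m : act_weyl (u * v) m = act_weyl u (act_weyl v m).
Proof. exact: wactM. Qed.
Let act_weyl_comm x y m :
  act_weyl (gen (@weyl_comm F) x) (act_weyl (gen (@weyl_comm F) y) m) =
  act_weyl (gen (@weyl_comm F) y) (act_weyl (gen (@weyl_comm F) x) m)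
  + weyl_comm F x y *: m.
Proof. exact: wact_gen_comm. Qed.
Let act_heis_comm n k m : act_heis n (act_heis k m) =
  act_heis k (act_heis n m) + heis_comm kappa n k *: m.
Proof. exact: wact_gen_comm. Qed.

Let A : qfield T := tensor_a W act_weyl_linear M1_a_smooth.
Let S : qfield T := tensor_as W act_weyl_linear M1_as_smooth.
Let b : qfield T := tensor_b V act_heis_linear N1_smooth.

Let wakimotoE x t : wakimoto kappa lam mu eta x t =
  \sum_(s <- msupp x) x@_s *: affine_basis_act kappa A S b s t.
Proof. exact: (wakimoto_actE kappa act_weyl_linear act_weylM act_weyl_comm
  act_heis_linear M1_a_smooth M1_as_smooth N1_smooth x t). Qed.

Let wact_comm := weyl_act_commutator (W := W) act_weyl_linear act_weyl_comm.
Let hact_comm := heis_act_commutator (V := V) act_heis_linear act_heis_comm.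

Let wh_comm := weyl_heis_act_comm act_weyl_linear act_heis_linear.

Let SS : fcomm S S.
Proof. exact: weyl_asas. Qed.
Let AA : fcomm A A.
Proof. exact: weyl_aa. Qed.
Let Ab : fcomm A b.
Proof. exact: weyl_a_heis wh_comm _ _. Qed.
Let Sb : fcomm S b.
Proof. exact: weyl_as_heis wh_comm _ _. Qed.
Let AS n m t : A n (S m t) = S m (A n t) + fone T (n + m) t.
Proof. exact: (weyl_aas _ wact_comm _ _ n m t). Qed.
Let bb n m t : b n (b m t) =
  b m (b n t) + (2 * (kappa + 2) * n%:~R) *: fone T (n + m) t.
Proof. exact: (heis_heis _ hact_comm _ n m t). Qed.

Lemma wakimoto_smooth : (forall u : T, u + u = 0 -> u = 0) ->
  smooth_module kappa (wakimoto kappa lam mu eta).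
Proof.
by move=> two_inj; exact: (affine_act_smooth AA SS Ab Sb AS bb two_inj wakimotoE).
Qed.

Let tensZl a (v : V) (u : W) : tens (a *: v) u = a *: tens v u :> T.
Proof.
rewrite -[a *: v]addr0 tens_linearl.
have := tens_linearl (-1) (0 : V) 0 u; rewrite scaler0 addr0 scaleN1r addNr => ->.
by rewrite addr0.
Qed.

Let tensZr a (v : V) (u : W) : tens v (a *: u) = a *: tens v u :> T.
Proof.
rewrite -[a *: u]addr0 tens_linearr.
have := tens_linearr (-1) v (0 : W) 0; rewrite scaler0 addr0 scaleN1r addNr => ->.
by rewrite addr0.
Qed.

Let Aw (i : nat) : A i w = lam i *: w.
Proof.
have E : act_weyl (gen (@weyl_comm F) (Wa i)) (M1_vec lam mu) = lam i *: M1_vec lam mu.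
  exact: (@wact_vac F weyl_gen (@weyl_comm F) annihilator (M1_char lam mu) (Wa i)).
rewrite -tensZl -E; exact: weyl_act_tens.
Qed.

Let Sw (i : nat) : (0 < i)%N -> S i w = mu i *: w.
Proof.
move=> i0.
have E : act_weyl (gen (@weyl_comm F) (Was i)) (M1_vec lam mu) = mu i *: M1_vec lam mu.
  exact: (@wact_vac F weyl_gen (@weyl_comm F) annihilator (M1_char lam mu) (Was i)).
rewrite -tensZl -E; exact: weyl_act_tens.
Qed.

Let bw (i : nat) : b i w = eta i *: w.
Proof.
have E : act_heis i (N1_vec kappa eta) = eta i *: N1_vec kappa eta.
  exact: (@wact_vac F int (heis_comm kappa) (fun n : int => (0 <= n)%O)
    (fun n => eta `|n|%N) i).
rewrite -tensZr -E; exact: heis_act_tens.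
Qed.

Lemma wakimoto_e_vec (i : nat) :
  wakimoto kappa lam mu eta (mode F SE i) w = lam i *: w.
Proof. by rewrite (affine_act_mode wakimotoE) -Aw. Qed.

Lemma wakimoto_h_vec (n : nat) : (M <= n)%N -> (N < n)%N ->
  wakimoto kappa lam mu eta (mode F SH n) w =
  (- (2 * \sum_(1 <= l < M.+1) mu l * lam (n - l)%N) + eta n) *: w.
Proof.
move=> Mn Nn; rewrite (affine_act_mode wakimotoE).
exact: eigen_h Aw Sw bw lam0 mu0 n Mn Nn.
Qed.

Lemma wakimoto_f_vec (n : nat) : (M + N < n)%N -> (2 * M <= n)%N -> (P < n)%N ->
  wakimoto kappa lam mu eta (mode F SF n) w =
  (- (\sum_(k1 < n.+1) \sum_(k2 < n.+1)
         \sum_(k3 < n.+1 | [&& (1 <= k1)%N, (1 <= k2)%N & (k1 + k2 + k3 == n)%N])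
           mu k1 * mu k2 * lam k3)
    + \sum_(j1 < n.+1)
        \sum_(j2 < n.+1 | (1 <= j1)%N && (j1 + j2 == n)%N) mu j1 * eta j2
    - kappa * n%:R * mu n) *: w.
Proof.
move=> MNn MMn Pn; rewrite (affine_act_mode wakimotoE).
exact: (eigen_f kappa SS Sb Aw Sw bw lam0 mu0 eta0 MNn MMn Pn).
Qed.

End WhittakerModules.

Lemma wakimoto_vec_form (F : comNzRingType) (kappa : F) (lam mu eta : nat -> F) :
  exists2 phi : tensor (M1 lam mu) (N1 kappa eta) -> F^o,
    linear phi & phi (wakimoto_vec kappa lam mu eta) = 1.
Proof.
(* The partner with which a generator has a non-zero commutator, that commutator being [dw]. *)
pose sw (x : weyl_gen) := match x with Wa n => Was (- n) | Was n => Wa (- n) end.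
pose dw (x : weyl_gen) : F := match x with Wa _ => 1 | Was _ => -1 end.
have eqWa n m : (Wa n == Wa m) = (n == m) by apply/eqP/eqP => [[]|->].
have eqWas n m : (Was n == Was m) = (n == m) by apply/eqP/eqP => [[]|->].
have wN x y : weyl_comm F y x = - weyl_comm F x y.
  by case: x => n; case: y => m /=; rewrite ?oppr0 ?opprK.
have wDD x y : annihilator x -> annihilator y -> weyl_comm F x y = 0.
  case: x => n; case: y => m //= n0 m0.
    by have -> : (n + m == 0) = false by lia.
  by have -> : (m + n == 0) = false by [lia]; rewrite oppr0.
have wNN x y : ~~ annihilator x -> ~~ annihilator y -> weyl_comm F x y = 0.
  case: x => n; case: y => m //= n0 m0.
    by have -> : (n + m == 0) = false by lia.
  by have -> : (m + n == 0) = false by [lia]; rewrite oppr0.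
have wDN x y : annihilator x -> ~~ annihilator y ->
    weyl_comm F x y = dw x * (y == sw x)%:R.
  case: x => n; case: y => m //= _ _; rewrite ?mulr0 ?mul1r ?mulN1r //.
    by rewrite eqWas; congr (_%:R); congr nat_of_bool; lia.
  by rewrite eqWa; congr (- _%:R); congr nat_of_bool; lia.
(* The partner of b(n) is b(-n). For n = 0 it is not a creator, which is harmless as [hd 0] is 0; at
   kappa = -2 every coefficient vanishes and the form still exists. *)
pose hd (n : int) : F := 2 * (kappa + 2) * n%:~R.
have hN n m : heis_comm kappa m n = - heis_comm kappa n m.
  rewrite /heis_comm [m + n]addrC; case: (n + m =P 0) => [nm|_].
    by have -> : m = - n by [lia]; rewrite intrN; ring.
  by rewrite mulr0n !mulr0 oppr0.
have hDD (n m : int) : (0 <= n)%O -> (0 <= m)%O -> heis_comm kappa n m = 0.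
  move=> n0 m0; rewrite /heis_comm; case: (n + m =P 0) => [nm|_]; last by rewrite mulr0.
  by have -> : n = 0 by [lia]; rewrite mulr0 mul0r.
have hNN (n m : int) : ~~ (0 <= n)%O -> ~~ (0 <= m)%O -> heis_comm kappa n m = 0.
  move=> n0 m0; rewrite /heis_comm; have -> : (n + m == 0) = false by lia.
  by rewrite mulr0.
have hDN (n m : int) : (0 <= n)%O -> ~~ (0 <= m)%O ->
    heis_comm kappa n m = hd n * (m == - n)%:R.
  by move=> _ _; rewrite /heis_comm /hd; congr (_ * _%:R); congr nat_of_bool; lia.
pose f1 : M1 lam mu -> F^o := vac_coef sw dw.
pose f2 : N1 kappa eta -> F^o := @vac_coef F int _ (fun n : int => (0 <= n)%O) _ -%R hd.
have L1 : linear f1 by exact: vac_coef_linear.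
have L2 : linear f2 by exact: vac_coef_linear.
exists (tens_form f1 f2); first exact: tens_form_linear.
rewrite /wakimoto_vec tens_formE//.
by rewrite [f1 _](vac_coef_vac _ wN wDD wNN wDN)
  [f2 _](vac_coef_vac _ hN hDD hNN hDN) mulr1.
Qed.

Lemma addrr_eq0_half (F : comNzRingType) (V : lmodType F) (h : F) :
  h * 2 = 1 -> forall u : V, u + u = 0 -> u = 0.
Proof.
by move=> h2 u uu; rewrite -[u]scale1r -h2 -scalerA scaler_nat mulr2n uu scaler0.
Qed.

Theorem proposition7p2 (R : realType) (kappa : R[i])
    (lam mu eta : nat -> R[i]) (N M P : nat)
    (M_ge1 : (1 <= M)%N)
    (lamN : lam N != 0) (muM : mu M != 0) (etaP : eta P != 0)
    (lam0 : forall i, (0 < i)%N -> lam (N + i)%N = 0)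
    (mu0 : forall i, (0 < i)%N -> mu (M + i)%N = 0)
    (eta0 : forall i, (0 < i)%N -> eta (P + i)%N = 0) :
  let q := maxn M (N + 1) in
  let r := maxn (M + N + 1) (maxn (2 * M) (P + 1)) in
  let rho := wakimoto kappa lam mu eta in
  let w := wakimoto_vec kappa lam mu eta in
  let A (i : nat) : R[i] := lam i in
  let B (i : nat) : R[i] :=
    - (2 * \sum_(1 <= l < M.+1) mu l * lam (q + i - l)%N) + eta (q + i)%N in
  let C (i : nat) : R[i] :=
    - (\sum_(k1 < (r + i).+1) \sum_(k2 < (r + i).+1)
         \sum_(k3 < (r + i).+1 |
                 [&& (1 <= k1)%N, (1 <= k2)%N & (k1 + k2 + k3 == r + i)%N])
           mu k1 * mu k2 * lam k3)
    + \sum_(j1 < (r + i).+1)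
        \sum_(j2 < (r + i).+1 | (1 <= j1)%N && (j1 + j2 == r + i)%N)
          mu j1 * eta j2
    - kappa * (r + i)%:R * mu (r + i)%N in
  let is_psi (psi : Pqr R[i] q r -> R[i]) :=
    [/\ lie_character psi,
        psi (PK q r) = kappa,
        forall i, psi (Pe q r i) = A i,
        forall i, psi (Ph q r i) = B i
      & forall i, psi (Pf q r i) = C i] in
  [/\ (0 < q < r)%N,
      smooth_module kappa rho,
      exists! psi, is_psi psi
    & forall psi, is_psi psi ->
        generalized_whittaker_module kappa psi
          (cyclic_act rho w) (cyclic_vec rho w)].
Proof.
have vanish (s : nat -> R[i]) n : (forall i, (0 < i)%N -> s (n + i)%N = 0) ->
    forall i, (n < i)%N -> s i = 0.
  by move=> s0 i ni; rewrite -(subnKC (ltnW ni)) s0// subn_gt0.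
move=> q r rho w A B C is_psi.
have lamv := vanish _ _ lam0; have muv := vanish _ _ mu0.
have etav := vanish _ _ eta0.
have sm : smooth_module kappa rho.
  apply: (wakimoto_smooth (kappa := kappa) lamv muv etav).
  (* Dividing by 2 serves the antisymmetry argument for two modes of f. *)
  have h2 : (2^-1 : R[i]) * 2 = 1 by rewrite mulVf// pnatr_eq0.
  exact: (addrr_eq0_half h2).
have [phi phiL phiw] := wakimoto_vec_form kappa lam mu eta.
have rhoe (i : nat) : rho (mode _ SE i) w = A i *: w.
  exact: (wakimoto_e_vec kappa lamv muv etav).
have rhoh (i : nat) : rho (mode _ SH (q + i)%N) w = B i *: w.
  by apply: (wakimoto_h_vec kappa lamv muv etav); rewrite /q; lia.
have rhof (i : nat) : rho (mode _ SF (r + i)%N) w = C i *: w.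
  by apply: (wakimoto_f_vec kappa lamv muv etav); rewrite /r; lia.
split=> //.
(* The strict inequality q < r uses M >= 1, through N + 1 < M + N + 1. *)
- by rewrite /q /r; lia.
- exact: (whittaker_function_ex1 sm phiL phiw rhoe rhoh rhof).
move=> psi; exact: (cyclic_whittaker sm phiL phiw rhoe rhoh rhof).
Qed.
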